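(* Let $\lambda>0$ or let $\mathcal{U}_{\mathrm{ad}}$ be bounded. Then the identification problem $$\min_{(y,w)\in Y\times\mathcal{U}_{\mathrm{ad}}}\ \mathcal{J}(y,w)\quad\text{subject to}\quad E\dot x=(J-R)x+Bu,\ \ x_1(0)=x_{1,0},\ \ y=B^\top x,$$ where $w=(J,R,B,x_{1,0})$ and $$\mathcal{J}(y,w)=\frac12\int_0^T|y(t)-y_{\rm data}(t)|^2\,\mathrm{d}t+\frac{\lambda}{2}|w-w_{\rm ref}|^2,$$ admits a global minimum.
   Context: Fix $T>0$, dimensions $m\ge1$ and $1\le r\le n$, a constant $\epsilon>0$, a parameter $\lambda\ge 0$, an input $u\in C^1([0,T],\mathbb{R}^m)$, data $y_{\rm data}\in L^2((0,T),\mathbb{R}^m)$, and reference data $w_{\rm ref}\in W$, where $$W=\mathbb{R}^{n\times n}\times\mathbb{R}^{n\times n}\times\mathbb{R}^{n\times m}\times\mathbb{R}^r$$ carries the Euclidean (Frobenius) norm $|\cdot|$. Let $E=\mathrm{diag}(I_r,0)\in\mathbb{R}^{n\times n}$. Vectors $x\in\mathbb{R}^n$ are split as $x=(x_1,x_2)$ with $x_1\in\mathbb{R}^r$ (differential part) and $x_2\in\mathbb{R}^{n-r}$ (algebraic part), and $n\times n$ matrices are partitioned into blocks accordingly; $J_{22},R_{22}$ denote the lower-right $(n-r)\times(n-r)$ blocks. The admissible set is $$\mathcal{U}_{\mathrm{ad}}=\{w=(J,R,B,x_{1,0})\in W:\ J^\top=-J,\ R\succeq0,\ \sigma_{\min}(J_{22}-R_{22})\ge\epsilon\},$$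 where $R\succeq0$ means $R$ is symmetric positive semi-definite and $\sigma_{\min}$ is the smallest singular value (the last condition is void if $r=n$). The output space is $Y=H^1((0,T),\mathbb{R}^m)$. For $w\in\mathcal{U}_{\mathrm{ad}}$ the state equation $E\dot x=(J-R)x+Bu$, $x_1(0)=x_{1,0}$, is an index-1 differential-algebraic equation: only the differential part $x_1$ is prescribed at time $0$, and $x_2$ is determined by the algebraic rows. The solution $x$ is sought in $H^1((0,T),\mathbb{R}^n)$, and a pair $(y,w)$ is feasible if $y=B^\top x$ for the solution $x$ of the state equation with parameters $w$. *)

(* Defs.v *)
From HB Require Import structures.
From mathcomp Require Import all_boot all_order all_algebra.
From mathcomp Require Import all_classical all_reals all_analysis.
Set Implicit Arguments.
Unset Strict Implicit.
Unset Printing Implicit Defensive.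
Import Order.TTheory GRing.Theory Num.Theory.
Import numFieldNormedType.Exports.
Local Open Scope classical_set_scope.
Local Open Scope ring_scope.

(* Conventions: n = r + s, so that r is the number of differential variables,
   s = n - r the number of algebraic ones, and the block partition of vectors
   and matrices is the one of the type indices.  An element of L^2((0,T)) or
   H^1((0,T)) is given by a representative R -> R; its values outside ]0,T[
   are irrelevant.  Vector-valued spaces are taken componentwise. *)

Definition norm2 {R : realType} {p q : nat} (A : 'M[R]_(p, q)) : R :=
  Num.sqrt (\sum_i \sum_j A i j ^+ 2).

Definition psd {R : realType} {k : nat} (A : 'M[R]_k) : Prop :=
  A^T = A /\ forall v : 'cV[R]_k, 0 <= (v^T *m A *m v) 0 0.

Definition singular_values {R : realType} {k : nat} (A : 'M[R]_k) : set R :=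
  [set Num.sqrt a | a in [set a | eigenvalue (A^T *m A) a]].

(* Meaningful only for k > 0: the set of singular values is then finite and
   nonempty, and its infimum is its minimum. *)
Definition sigma_min {R : realType} {k : nat} (A : 'M[R]_k) : R :=
  inf (singular_values A).

Section Params.
Context {R : realType} {r s m : nat}.

(* (J, R, B, x_{1,0}) *)
Definition param : Type :=
  ('M[R]_(r + s) * 'M[R]_(r + s) * 'M[R]_(r + s, m) * 'cV[R]_r)%type.

Definition pJ (w : param) : 'M[R]_(r + s) := w.1.1.1.
Definition pR (w : param) : 'M[R]_(r + s) := w.1.1.2.
Definition pB (w : param) : 'M[R]_(r + s, m) := w.1.2.
Definition px0 (w : param) : 'cV[R]_r := w.2.

Definition param_dist (w w' : param) : R :=
  Num.sqrt (norm2 (pJ w - pJ w') ^+ 2 + norm2 (pR w - pR w') ^+ 2 +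
            norm2 (pB w - pB w') ^+ 2 + norm2 (px0 w - px0 w') ^+ 2).

Definition Uad (eps : R) : set param :=
  [set w | [/\ (pJ w)^T = - pJ w,
               psd (pR w)
             & (0 < s)%N -> eps <= sigma_min (drsubmx (pJ w) - drsubmx (pR w))]].

Definition param_bounded (A : set param) : Prop :=
  exists C : R, forall w, A w -> param_dist w (0, 0, 0, 0) <= C.

Definition Emx : 'M[R]_(r + s) := block_mx 1%:M 0 0 0.

End Params.
Arguments param : clear implicits.
Arguments Uad {R} r s m eps.
Arguments Emx {R} r s.

Section Spaces.
Context {R : realType}.
Local Notation mu := (@lebesgue_measure R).

Definition C1_closed (T : R) (f : R -> R) : Prop :=
  {within `[0, T], continuous f} /\
  exists2 df : R -> R, {within `[0, T], continuous df} &
    forall t, 0 < t < T -> is_derive t 1 f (df t).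

Definition L2 (T : R) (f : R -> R) : Prop := (f \_ `]0, T[) \in Lfun mu 2%:E.

(* C^1 functions with compact support in ]0, T[. *)
Definition test_function (T : R) (phi : R -> R) : Prop :=
  [/\ forall t, derivable phi t 1,
      continuous (derive1 phi)
    & exists K : set R, [/\ compact K, K `<=` `]0, T[
                          & forall t, ~ K t -> phi t = 0]].

Definition weak_derivative (T : R) (f g : R -> R) : Prop :=
  forall phi, test_function T phi ->
    \int[mu]_(t in `]0, T[) (f t * derive1 phi t) =
    - \int[mu]_(t in `]0, T[) (g t * phi t).

Definition H1 (T : R) (f : R -> R) : Prop :=
  L2 T f /\ exists2 g, L2 T g & weak_derivative T f g.

(* The value at 0 of an H^1 function is that of its continuous representative
   on [0, T]. *)
Definition initial_value (T : R) (f : R -> R) (c : R) : Prop :=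
  exists g : R -> R,
    [/\ {within `[0, T], continuous g},
        {ae mu, forall t, 0 < t < T -> f t = g t}
      & g 0 = c].

Definition C1_closed_vec (k : nat) (T : R) (f : R -> 'cV[R]_k) : Prop :=
  forall i, C1_closed T (fun t => f t i 0).

Definition L2_vec (k : nat) (T : R) (f : R -> 'cV[R]_k) : Prop :=
  forall i, L2 T (fun t => f t i 0).

Definition H1_vec (k : nat) (T : R) (f : R -> 'cV[R]_k) : Prop :=
  forall i, H1 T (fun t => f t i 0).

Definition weak_derivative_vec (k : nat) (T : R) (f g : R -> 'cV[R]_k) : Prop :=
  forall i, weak_derivative T (fun t => f t i 0) (fun t => g t i 0).

Definition initial_value_vec (k : nat) (T : R) (f : R -> 'cV[R]_k)
    (c : 'cV[R]_k) : Prop :=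
  forall i, initial_value T (fun t => f t i 0) (c i 0).

End Spaces.

Section Problem.
Context {R : realType} {r s m : nat}.
Local Notation mu := (@lebesgue_measure R).

Definition state_solution (T : R) (u : R -> 'cV[R]_m) (w : param R r s m)
    (x : R -> 'cV[R]_(r + s)) : Prop :=
  [/\ H1_vec T x,
      exists dx : R -> 'cV[R]_(r + s),
        [/\ L2_vec T dx, weak_derivative_vec T x dx
          & {ae mu, forall t, 0 < t < T ->
               Emx r s *m dx t = (pJ w - pR w) *m x t + pB w *m u t}]
    & initial_value_vec T (fun t => usubmx (x t)) (px0 w)].

Definition feasible (T eps : R) (u y : R -> 'cV[R]_m) (w : param R r s m) : Prop :=
  [/\ H1_vec T y,
      Uad r s m eps w
    & exists2 x, state_solution T u w x &
        {ae mu, forall t, 0 < t < T -> y t = (pB w)^T *m x t}].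

Definition cost (T lambda : R) (ydata : R -> 'cV[R]_m) (wref : param R r s m)
    (y : R -> 'cV[R]_m) (w : param R r s m) : R :=
  2^-1 * (\int[mu]_(t in `]0, T[) (norm2 (y t - ydata t) ^+ 2)) +
  lambda / 2 * param_dist w wref ^+ 2.

End Problem.

(* Main.v *)
(* For an admissible w the matrix A = J - R has an invertible block A22, because
   sigma_min A22 is the coercivity constant of x |-> |A22 x|.  Eliminating x2
   turns the state equation into a linear ODE x1' = M x1 + N u, solved with the
   matrix exponential.  A weak solution coincides almost everywhere with this
   classical one: du Bois-Reymond's lemma makes its continuous representative
   classical, and Gronwall's inequality gives uniqueness.  Hence the problem is
   the minimisation over w of a reduced cost.

   A minimising sequence w_n is bounded, so it converges along an ultrafilter
   on the indices.  The inverses of the A22 blocks are bounded by 1 / eps, so they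
   converge as well, to the inverse of the limit; the limit is admissible, the
   outputs converge uniformly by Gronwall, and convexity of the misfit shows
   that the limit is optimal. *)
Require Import Defs.
From mathcomp Require Import all_boot all_order all_algebra.
From mathcomp Require Import all_classical all_reals all_analysis.
From mathcomp Require Import measurable_realfun ring lra.
Set Implicit Arguments.
Unset Strict Implicit.
Unset Printing Implicit Defensive.
Import Order.TTheory GRing.Theory Num.Theory.
Import numFieldNormedType.Exports.
Local Open Scope classical_set_scope.
Local Open Scope ring_scope.

(** * Squared Euclidean norm and smallest singular value *)

(** Compactness is sought among the parameters only, in finite dimension; trajectories and outputs
    are then recovered by solving the reduced equation. The constraint on [sigma_min], an infimum
    over eigenvalues, is awkward in limits, so it is first traded for the inequalities
    [eps ^+ 2 * sqn v <= sqn (A *m v)], one for each [v], which pass to limits entrywise. An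
    ultrafilter replaces subsequences because every bounded family of scalars converges along it:
    the entries of the parameters and of the inverses converge together, without successive
    extractions. Functions on the closed interval are extended by constants beyond the endpoints, so
    that calculus is done with functions continuous on the whole line, while the reduced equation is
    asked inside the open interval only. The C^1 regularity of the input enters because the
    algebraic part, hence the output, contains [u] itself and has to lie in H^1. *)

Lemma cvg_sumr {R : realType} {T : Type} {F : set_system T} {FF : Filter F}
    (I : Type) (s : seq I) (P : pred I) (f : I -> T -> R) (l : I -> R) :
  (forall i, P i -> f i x @[x --> F] --> l i) ->
  (\sum_(i <- s | P i) f i x) @[x --> F] --> \sum_(i <- s | P i) l i.
Proof.
move=> h; elim: s => [|a s IH].
  by under eq_fun do rewrite big_nil; rewrite big_nil; exact: cvg_cst.
under eq_fun do rewrite big_cons; rewrite big_cons.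
by case: ifPn => // /h ha; exact: cvgD.
Qed.

Section SquaredNorm.
Context {R : realType}.

Definition sqn {k : nat} (v : 'cV[R]_k) : R := \sum_i v i 0 ^+ 2.

Lemma sqn_mul k (v : 'cV[R]_k) : sqn v = (v^T *m v) 0 0.
Proof. by rewrite mxE; apply: eq_bigr => i _; rewrite mxE expr2. Qed.

Lemma sqn_ge0 k (v : 'cV[R]_k) : 0 <= sqn v.
Proof. by apply: sumr_ge0 => i _; exact: sqr_ge0. Qed.

Lemma sqn_coord_le k (v : 'cV[R]_k) i : v i 0 ^+ 2 <= sqn v.
Proof.
rewrite /sqn (bigD1 i)//= lerDl; apply: sumr_ge0 => j _; exact: sqr_ge0.
Qed.

Lemma sqn_eq0 k (v : 'cV[R]_k) : sqn v = 0 -> v = 0.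
Proof.
move=> v0; apply/colP => i; rewrite mxE; apply/eqP.
by rewrite -sqrf_eq0 eq_le sqr_ge0 -v0 sqn_coord_le.
Qed.

Lemma sqn0 k : sqn (0 : 'cV[R]_k) = 0.
Proof. by rewrite /sqn big1// => i _; rewrite mxE expr0n. Qed.

Lemma sqnZ k a (v : 'cV[R]_k) : sqn (a *: v) = a ^+ 2 * sqn v.
Proof. by rewrite /sqn mulr_sumr; apply: eq_bigr => i _; rewrite mxE exprMn. Qed.

Lemma sqn_gt0 k (v : 'cV[R]_k) : v != 0 -> 0 < sqn v.
Proof.
move=> v0; rewrite lt_neqAle sqn_ge0 andbT eq_sym.
by apply: contra v0 => /eqP /sqn_eq0 ->.
Qed.

(** Moving from [v] to [v - t *: G v] changes the form by [- 2 t |G v|^2] plus a term of order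
    [t^2]; for small [t] a nonnegative form that vanishes at [v] allows this only if [G v = 0]. *)
Lemma psd_form_ker k (G : 'M[R]_k) (v : 'cV[R]_k) : psd G ->
  (v^T *m G *m v) 0 0 = 0 -> G *m v = 0.
Proof.
move=> [GT G0] Gv; apply: sqn_eq0; set w := G *m v.
pose q := (w^T *m G *m w) 0 0.
have q0 : 0 <= q by exact: G0.
have wv : (w^T *m G *m v) 0 0 = sqn w by rewrite -mulmxA sqn_mul.
have vw : (v^T *m G *m w) 0 0 = sqn w.
  by rewrite sqn_mul {2}/w trmx_mul GT.
have a0 := sqn_ge0 w.
(* Close to the minimiser [|w|^2 / q] of the quadratic in [t]; the denominator [q + 1] stays
   positive when [q = 0]. *)
have [t [t0 tq]] : exists t, 0 <= t /\ t * (q + 1) = sqn w.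
  exists (sqn w / (q + 1)); split; first by rewrite divr_ge0//; lra.
  by rewrite divfK//; apply: lt0r_neq0; lra.
have := G0 (v - t *: w).
have -> : (v - t *: w)^T = v^T - t *: w^T by rewrite linearB linearZ.
rewrite mulmxBl mulmxBl !mulmxBr -!scalemxAr -!scalemxAl.
have qE : (w^T *m G *m w) 0 0 = q by [].
move: Gv wv vw qE.
move: (v^T *m G *m v) (w^T *m G *m v) (v^T *m G *m w) (w^T *m G *m w).
move=> X1 X2 X3 X4 e1 e2 e3 e4; rewrite !mxE e1 e2 e3 e4 => h.
have e : t * (t * q) = t * sqn w - t ^+ 2 by rewrite -tq; ring.
have t2 := sqr_ge0 t.
have h2 : sqn w * t <= 0 by lra.
have : sqn w ^+ 2 <= 0 by rewrite expr2 -{2}tq; nra.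
by rewrite -[_ <= 0]andbT -(sqr_ge0 (sqn w)) -eq_le sqrf_eq0 => /eqP.
Qed.

(** Row vectors, to match the extreme value theorem [EVT_min_rV]. *)
Lemma sqn_mulmx_continuous k (A : 'M[R]_k) :
  continuous (fun v : 'rV[R]_k => sqn (A *m v^T)).
Proof.
move=> v; rewrite /sqn.
apply: (@cvg_sumr _ _ (nbhs v) _ _ _ xpredT) => i _.
have -> : (fun v : 'rV[R]_k => (A *m v^T) i 0 ^+ 2) =
   (fun v : 'rV[R]_k => (\sum_j A i j * v 0 j) * (\sum_j A i j * v 0 j)).
  by apply/funext => x; rewrite mxE expr2; congr (_ * _);
    apply: eq_bigr => j _; rewrite mxE.
have -> : (A *m v^T) i 0 ^+ 2 = (\sum_j A i j * v 0 j) * (\sum_j A i j * v 0 j).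
  by rewrite mxE expr2; congr (_ * _); apply: eq_bigr => j _; rewrite mxE.
by apply: cvgM; apply: (@cvg_sumr _ _ (nbhs v) _ _ _ xpredT) => j _; apply: cvgM; try exact: cvg_cst;
  exact: coord_continuous.
Qed.

(* A minimiser of [sqn (A x)] on the unit sphere is an eigenvector of [A^T A]:
   it lies in the kernel of the positive semidefinite form [A^T A - c]. *)
Lemma min_eigen k (A : 'M[R]_k.+1) : exists c (v : 'cV[R]_k.+1),
  [/\ v != 0, A^T *m A *m v = c *: v & forall x, c * sqn x <= sqn (A *m x)].
Proof.
(* Writing the sphere with [1%:M] lets the continuity lemma for [sqn (A *m v^T)] also give its
   closedness. *)
pose S := [set v : 'rV[R]_k.+1 | sqn (1%:M *m v^T) = 1].
have S0 : S !=set0.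
  exists (delta_mx 0 0); rewrite /S /= mul1mx /sqn (bigD1 0)//= !mxE /= expr1n.
  rewrite big1 ?addr0// => i i0; rewrite !mxE/= (negbTE i0) expr0n//.
have cS : compact S.
  apply: bounded_closed_compact.
    exists 1; split; first exact: num_real.
    move=> M M1 v Sv; rewrite /= [leLHS]/Num.norm /= mx_normrE; apply: bigmax_le; first lra.
    move=> [i j] _ /=; rewrite ord1.
    have : v 0 j ^+ 2 <= 1.
      by rewrite -Sv mul1mx; have := sqn_coord_le (v^T) j; rewrite mxE.
    rewrite -(@expr1n R 2) -[v 0 j ^+ 2]real_normK ?num_real//.
    by rewrite ler_pXn2r// ?nnegrE// => /le_trans; apply; lra.
  apply: (@closed_comp _ _ (fun v : 'rV[R]_k.+1 => sqn (1%:M *m v^T)) [set 1]).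
    by move=> v _; exact: sqn_mulmx_continuous.
  exact: closed_eq.
have [v /set_mem Sv minv] := EVT_min_rV S0 cS
  (@continuous_subspaceT _ _ S _ (@sqn_mulmx_continuous _ A)).
move: Sv; rewrite /S/= mul1mx => v1.
pose c := sqn (A *m v^T).
have hc x : c * sqn x <= sqn (A *m x).
  have [->|x0] := eqVneq x 0; first by rewrite mulmx0 !sqn0 mulr0.
  have sx := sqn_gt0 x0.
  pose a := (Num.sqrt (sqn x))^-1.
  have a2 : a ^+ 2 * sqn x = 1.
    by rewrite /a exprVn sqr_sqrtr ?ltW// mulVf ?gt_eqF.
  have := minv (a *: x^T); rewrite inE /S/= mul1mx linearZ/= trmxK sqnZ a2.
  move=> /(_ erefl); rewrite -scalemxAr sqnZ -/c => h.
  have := ler_wpM2r (ltW sx) h.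
  by rewrite mulrAC a2 mul1r.
exists c, v^T; split => //.
  by apply/eqP => v0; move: v1; rewrite v0 sqn0 => /eqP; rewrite eq_sym oner_eq0.
have form x : (x^T *m (A^T *m A - c%:M) *m x) 0 0 = sqn (A *m x) - c * sqn x.
  rewrite mulmxBr mulmxBl mxE [X in _ + X]mxE mulmxA -trmx_mul -mulmxA -sqn_mul.
  by rewrite mul_mx_scalar -scalemxAl [X in - X]mxE -sqn_mul.
have : (A^T *m A - c%:M) *m v^T = 0.
  apply: psd_form_ker; last by rewrite form v1 mulr1 subrr.
  split; first by rewrite linearB/= trmx_mul trmxK tr_scalar_mx.
  by move=> x; rewrite form subr_ge0.
by rewrite mulmxBl mul_scalar_mx => /eqP; rewrite subr_eq0 => /eqP.
Qed.

(** The eigenvalue [c] of [min_eigen] serves both directions: its root is a singular value, so the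
    infimum lies below it, and its existence shows that the infimum is over a nonempty set.
    Conversely, the inequality evaluated at any eigenvector bounds its eigenvalue from below by
    [eps ^+ 2]. For [k = 0] both sides hold trivially. *)
Lemma le_sigma_min k (A : 'M[R]_k) eps : 0 < eps ->
  ((0 < k)%N -> eps <= sigma_min A) <->
  (forall v, eps ^+ 2 * sqn v <= sqn (A *m v)).
Proof.
case: k A => [|k] A eps0; split => // h.
- by move=> v; rewrite /sqn !big_ord0 mulr0.
- move=> v; have [c [x [x0 xc cmin]]] := min_eigen A.
  apply: le_trans (cmin v); apply: ler_wpM2r; first exact: sqn_ge0.
  have c0 : 0 <= c.
    rewrite -(pmulr_lge0 _ (sqn_gt0 x0)) sqn_mul.
    have -> : c * (x^T *m x) 0 0 = (x^T *m (c *: x)) 0 0.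
      by rewrite -scalemxAr [RHS]mxE.
    by rewrite -xc !mulmxA -trmx_mul -mulmxA -sqn_mul sqn_ge0.
  rewrite -[leRHS]sqr_sqrtr// ler_pXn2r ?nnegrE ?sqrtr_ge0// ?(ltW eps0)//.
  apply: le_trans (h isT) _; apply: ge_inf.
    by exists 0 => _ [a _ <-]; exact: sqrtr_ge0.
  (* [eigenvalue] refers to row vectors; transposing is harmless because [A^T *m A] is symmetric. *)
  exists c => //=; apply/eigenvalueP; exists x^T.
    by apply: trmx_inj; rewrite trmx_mul trmx_mul !trmxK xc linearZ/= trmxK.
  by apply: contra x0 => /eqP xT0; rewrite -(trmxK x) xT0 trmx0.
- move=> _; apply: lb_le_inf.
    have [c [x [x0 xc cmin]]] := min_eigen A.
    exists (Num.sqrt c); exists c => //=; apply/eigenvalueP; exists x^T.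
      by apply: trmx_inj; rewrite trmx_mul trmx_mul !trmxK xc linearZ/= trmxK.
    by apply: contra x0 => /eqP xT0; rewrite -(trmxK x) xT0 trmx0.
  move=> _ [a /= /eigenvalueP[x xa x0] <-].
  have xT : A^T *m A *m x^T = a *: x^T.
    by apply: trmx_inj; rewrite !trmx_mul linearZ/= !trmxK.
  have xT0 : x^T != 0.
    by apply: contra x0 => /eqP x0; rewrite -(trmxK x) x0 trmx0.
  have := h x^T.
  rewrite [leRHS]sqn_mul trmx_mul trmxK -mulmxA.
  rewrite -[X in X *m _](trmxK x) (mulmxA A^T) xT -scalemxAr [leRHS]mxE.
  rewrite -sqn_mul ler_pM2r ?sqn_gt0// => ea.
  have a0 : 0 <= a by apply: le_trans ea; exact: sqr_ge0.
  by rewrite -(ler_pXn2r (_ : 0 < 2)%N)// ?nnegrE ?sqrtr_ge0 ?(ltW eps0)// sqr_sqrtr.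
Qed.

Lemma coercive_unitmx k (A : 'M[R]_k) eps : 0 < eps ->
  (forall v, eps ^+ 2 * sqn v <= sqn (A *m v)) -> A \in unitmx.
Proof.
move=> eps0 h; rewrite -unitmx_tr -row_free_unit; apply/row_freeP.
suff : row_free A^T by move/row_freeP.
rewrite -kermx_eq0; apply/rowV0P => v /sub_kermxP vA.
have : A *m v^T = 0 by apply: trmx_inj; rewrite trmx_mul trmxK vA trmx0.
move=> Av; have := h v^T; rewrite Av sqn0 pmulr_rle0 ?exprn_gt0// => v0.
have /sqn_eq0 v0' : sqn v^T = 0 by apply/eqP; rewrite eq_le v0 sqn_ge0.
by rewrite -(trmxK v) v0' trmx0.
Qed.

(** Coercivity applied to column [j] of [invmx A], which [A] sends to a unit vector, bounds the
    Euclidean norm of the whole column. *)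
Lemma coercive_invmx_bound k (A : 'M[R]_k) eps i j : 0 < eps ->
  (forall v, eps ^+ 2 * sqn v <= sqn (A *m v)) -> `|invmx A i j| <= eps^-1.
Proof.
move=> eps0 h; have Au := coercive_unitmx eps0 h.
have := h (invmx A *m delta_mx j 0); rewrite mulKVmx//.
have -> : sqn (delta_mx j 0 : 'cV[R]_k) = 1.
  rewrite /sqn (bigD1 j)//= mxE !eqxx/= expr1n big1 ?addr0// => l lj.
  by rewrite mxE (negbTE lj) expr0n.
rewrite -colE => h1.
have := sqn_coord_le (col j (invmx A)) i; rewrite mxE => h2.
rewrite -(ler_pXn2r (_ : 0 < 2)%N)// ?nnegrE ?invr_ge0 ?(ltW eps0)//.
rewrite real_normK ?num_real// exprVn; apply: le_trans h2 _.
by rewrite -[leRHS]mulr1 ler_pdivlMl// exprn_gt0.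
Qed.

End SquaredNorm.

(** * Primitives of continuous functions *)

Section Calculus.
Context {R : realType}.
Local Notation mu := (@lebesgue_measure R).

Lemma is_derive1_continuous (f : R -> R) (t d : R) :
  is_derive t 1 f d -> {for t, continuous f}.
Proof.
by move=> h; apply: differentiable_continuous; apply/derivable1_diffP.
Qed.

Lemma continuous_segment_integrable (f : R -> R) (a b : R) : continuous f ->
  mu.-integrable `[a, b] (EFin \o f).
Proof.
move=> cf; apply: continuous_compact_integrable; first exact: segment_compact.
exact: continuous_subspaceT.
Qed.

Lemma continuous_primitive_gt (f : R -> R) (a t : R) : continuous f -> a < t ->
  is_derive t 1 (fun x => \int[mu]_(s in `[a, x]) f s) (f t).
Proof.
move=> cf at_; have tu : t < t + 1 by rewrite ltrDl.
have [|||d e] := @continuous_FTC1_closed R f a t (t + 1) tu.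
- exact: continuous_segment_integrable.
- exact: at_.
- exact: cf.
by apply: DeriveDef; [exact: d|rewrite -derive1E e].
Qed.

(** [continuous_primitive_gt] differentiates only to the right of a fixed base point. To cover the
    whole line the base point recedes with [x], and subtracting the value at [0] makes the result
    independent of it. *)
Lemma continuous_primitive (f : R -> R) : continuous f ->
  exists2 F : R -> R, F 0 = 0 & forall t : R, is_derive t 1 F (f t).
Proof.
move=> cf; pose I a x := \int[mu]_(s in `[a, x]) f s.
have IE a b x : a <= b -> b <= 0 -> b <= x -> I a x - I a 0 = I b x - I b 0.
  move=> ab b0 bx.
  have h y : b <= y -> I a y - I a b = \int[mu]_(s in `]b, y]) f s.
    move=> byy; rewrite /I (@Rintegral_itvB _ f (BLeft a) (BRight y) b)//.
      exact: continuous_segment_integrable.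
  have hb y : \int[mu]_(s in `]b, y]) f s = I b y.
    rewrite /I Rintegral_itv_obnd_cbnd//.
    apply: integrableS (continuous_segment_integrable b y cf) => //=.
    exact: subset_itv_oc_cc.
  have h1 := h x bx; have h2 := h 0 b0; rewrite !hb in h1 h2.
  by rewrite -h1 -h2; ring.
pose F x := I (- (`|x| + 1)) x - I (- (`|x| + 1)) 0.
exists F; first by rewrite /F subrr.
(* One base point to the left of all those used for [x] at distance less than 1 from [t]. *)
move=> t; pose N := - (`|t| + 2).
have dN : is_derive t 1 (fun x => I N x - I N 0) (f t).
  have dI : is_derive t 1 (I N) (f t).
    apply: continuous_primitive_gt => //; rewrite /N.
    by have := ler_norm (- t); rewrite normrN; lra.
  by apply: is_derive_eq; rewrite subr0.
apply: near_eq_is_derive dN.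
near=> x; rewrite /F; apply: IE; last 2 first.
- by have := normr_ge0 x; lra.
- by have := ler_norm (- x); rewrite normrN; lra.
rewrite /N lerN2.
have xt : `|t - x| < 1 by near: x; apply/nbhs_ballP; exists 1 => /=.
have := ler_normD (x - t) t; rewrite subrK distrC; lra.
Unshelve. all: by end_near. Qed.

End Calculus.

(** * L2 functions and weak derivatives *)

Section AlmostEverywhere.
Context {R : realType}.
Local Notation mu := (@lebesgue_measure R).

Lemma ae_imply (P Q : R -> Prop) : (forall t, P t -> Q t) ->
  {ae mu, forall t, P t} -> {ae mu, forall t, Q t}.
Proof. by move=> PQ; apply: negligibleS; apply: subsetC; exact: PQ. Qed.

Lemma ae_and (P Q : R -> Prop) :
  {ae mu, forall t, P t} -> {ae mu, forall t, Q t} ->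
  {ae mu, forall t, P t /\ Q t}.
Proof.
move=> hP hQ; have := negligibleU hP hQ; rewrite -setCI.
exact.
Qed.

Lemma ae_forall (I : finType) (P : I -> R -> Prop) :
  (forall i, {ae mu, forall t, P i t}) -> {ae mu, forall t, forall i, P i t}.
Proof.
move=> h; suff : forall s : seq I,
    {ae mu, forall t, forall i, i \in s -> P i t}.
  by move=> /(_ (enum I)); apply: ae_imply => t ht i; apply: ht; rewrite mem_enum.
elim=> [|i s IH].
  by apply: (@aeW _ _ _ mu) => t i; rewrite in_nil.
apply: ae_imply (ae_and (h i) IH) => t [Pi Ps] j; rewrite inE => /orP[/eqP->//|].
exact: Ps.
Qed.

End AlmostEverywhere.

Section WeakDerivatives.
Context {R : realType} (T : R) (T0 : 0 < T).
Local Notation mu := (@lebesgue_measure R).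
Local Notation D := (`]0, T[%classic : set R).

Lemma measurable_fun_continuous (f : R -> R) (A : set R) :
  measurable A -> continuous f -> measurable_fun A f.
Proof.
move=> mA cf; apply: measurable_funS (measurableT) _ _ => //.
exact: continuous_measurable_fun.
Qed.

Lemma continuous_integrable_oo (f : R -> R) : continuous f ->
  mu.-integrable D (EFin \o f).
Proof.
move=> cf; apply: integrableS (continuous_segment_integrable 0 T cf) => //.
exact: subset_itv_oo_cc.
Qed.

Lemma Rintegral_oo_cc (f : R -> R) : mu.-integrable `[0, T] (EFin \o f) ->
  \int[mu]_(t in D) f t = \int[mu]_(t in `[0, T]) f t.
Proof.
move=> intf; rewrite Rintegral_itv_bndo_bndc; last first.
  apply: integrableS intf => //; exact: subset_itv_oo_cc.
rewrite Rintegral_itv_obnd_cbnd//.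
apply: integrableS intf => //; exact: subset_itv_oc_cc.
Qed.

Lemma measurable_oo : measurable (D : set (measurableTypeR R)).
Proof. exact: measurable_itv. Qed.

Lemma L2P (f : R -> R) : L2 T f <->
  measurable_fun D f /\ mu.-integrable D (EFin \o (fun t => f t ^+ 2)).
Proof.
have sqE : (fun t => (f \_ D) t ^+ 2) = (fun t => f t ^+ 2) \_ D.
  by apply/funext => t; rewrite !patchE; case: ifPn => // _; rewrite expr0n.
split=> [fL|[mf if2]].
  have := fL; rewrite /L2 inE => /andP[]; rewrite !inE/= => mf _; split.
    exact/measurable_restrictT.
  apply/integrable_mkcond => //.
  by rewrite restrict_EFin -sqE; exact: Lfun2_integrable_sqr fL.
rewrite /L2 inE; apply/andP; rewrite !inE /=; split.
  by apply/(measurable_restrictT _ _).1.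
rewrite /finite_norm unlock; apply: poweR_lty.
have /integrableP[_] : mu.-integrable setT (EFin \o ((fun t => f t ^+ 2) \_ D)).
  have := (@integrable_mkcond _ _ R mu D _ _).1 if2.
  by rewrite restrict_EFin; apply; exact: measurable_itv.
apply: le_lt_trans; rewrite le_eqVlt; apply/orP; left; apply/eqP.
apply: eq_integral => x _; rewrite /= -sqE.
rewrite powR_mulrn// real_normK ?num_real//.
by rewrite ger0_norm ?sqr_ge0.
Qed.



Lemma L2_mul (f g : R -> R) : L2 T f -> L2 T g ->
  mu.-integrable D (EFin \o (fun t => f t * g t)).
Proof.
move=> fL gL; have /Lfun1_integrable := Lfun2_mul_Lfun1 fL gL.
have -> : EFin \o ((f \_ D) \* (g \_ D)) = (EFin \o (fun t => f t * g t)) \_ D.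
  apply/funext => t; rewrite /= !patchE; case: ifPn => //= _.
  by rewrite mulr0.
by move=> h; apply/(@integrable_mkcond _ _ R mu D _ measurable_oo).
Qed.

Lemma continuous_L2 (f : R -> R) : continuous f -> L2 T f.
Proof.
move=> cf; apply/L2P; split; first exact: measurable_fun_continuous.
apply: continuous_integrable_oo => t.
by under eq_fun do rewrite expr2; apply: continuousM; exact: cf.
Qed.

Lemma L2_integrable (f : R -> R) : L2 T f -> mu.-integrable D (EFin \o f).
Proof.
move=> fL; have c1 : continuous (cst 1 : R -> R) by exact: cst_continuous.
have := L2_mul fL (continuous_L2 c1).
rewrite (_ : (fun t => f t * cst 1 t) = f)//.
by apply/funext => t; rewrite mulr1.
Qed.

Lemma L2_sub (f g : R -> R) : L2 T f -> L2 T g -> L2 T (fun t => f t - g t).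
Proof.
move=> /[dup] fL /L2P[mf f2] /[dup] gL /L2P[mg g2]; apply/L2P; split.
  exact: measurable_funB.
have fg := L2_mul fL gL.
have h := integrableD measurable_oo (integrableD measurable_oo f2 g2)
  (integrableZl measurable_oo (-2) fg).
move: h; congr (is_true (integrable _ _ _)); apply/funext => t.
by rewrite /= -EFinM -!EFinD; congr (_%:E); ring.
Qed.

Lemma maxr_continuous (f g : R -> R) : continuous f -> continuous g ->
  continuous (fun t => Num.max (f t) (g t)).
Proof.
move=> cf cg t; under eq_fun do rewrite maxr_absE.
apply: cvgM; last exact: cvg_cst.
apply: cvgD; first by apply: cvgD; [exact: cf|exact: cg].
by apply: cvg_norm; apply: cvgB; [exact: cf|exact: cg].
Qed.

(** The retraction of the line onto the segment: composition with it turns continuity within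
    [[0, T]] into continuity everywhere and changes nothing inside. *)
Definition clamp (t : R) : R := Num.max 0 (Num.min t T).

Lemma clamp_itv t : 0 <= clamp t <= T.
Proof.
by rewrite /clamp le_max lexx/= ge_max ge_min lexx orbT (ltW T0).
Qed.

Lemma clamp_id t : 0 <= t <= T -> clamp t = t.
Proof. by move=> /andP[t0 tT]; rewrite /clamp min_l// max_r. Qed.

Lemma clamp_continuous : continuous clamp.
Proof.
have -> : clamp = fun t => Num.max 0 (- Num.max (- t) (- T)).
  by apply/funext => t; rewrite /clamp oppr_max !opprK.
apply: maxr_continuous; first exact: cst_continuous.
move=> t; apply: cvgN; apply: maxr_continuous; last exact: cst_continuous.
by move=> s; apply: cvgN; exact: cvg_id.
Qed.

Lemma continuous_clamp (f : R -> R) :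
  {within `[0, T], continuous f} -> continuous (f \o clamp).
Proof.
move=> /subspace_continuousP cf t.
have ci : `[0, T]%classic (clamp t) by rewrite /= in_itv/= clamp_itv.
apply: cvg_comp (cf _ ci).
move=> A nA; have hn : nbhs t (clamp @^-1` [set s | `[0, T]%classic s -> A s]).
  exact: (@clamp_continuous t _ nA).
suff : nbhs t (clamp @^-1` A) by [].
by apply: filterS hn => s /= h; apply: h; rewrite in_itv/= clamp_itv.
Qed.

Lemma test_function_continuous (phi : R -> R) : test_function T phi ->
  continuous phi.
Proof.
move=> [d _ _] t; apply: differentiable_continuous; exact/derivable1_diffP.
Qed.

Lemma test_function_out (phi : R -> R) t : test_function T phi ->
  ~~ (0 < t < T) -> phi t = 0.
Proof.
move=> [_ _ [K [_ KD K0]]] t0; apply: K0 => /KD; rewrite /= in_itv/=.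
exact/negP.
Qed.

(** Weak derivatives see functions only under the integral sign. This carries the weak equation over
    to continuous representatives. *)
Lemma ae_weak_derivative (f g f' g' : R -> R) :
  L2 T f -> L2 T g -> continuous f' -> continuous g' ->
  {ae mu, forall t, 0 < t < T -> f t = f' t} ->
  {ae mu, forall t, 0 < t < T -> g t = g' t} ->
  weak_derivative T f g -> weak_derivative T f' g'.
Proof.
have key (h h' p : R -> R) : L2 T h -> continuous h' -> continuous p ->
    {ae mu, forall t, 0 < t < T -> h t = h' t} ->
    \int[mu]_(t in D) (h t * p t) = \int[mu]_(t in D) (h' t * p t).
  move=> /L2P[mh _] ch' cp hh'; congr fine; apply: ae_eq_integral => //.
  - by apply/measurable_EFinP; apply: measurable_funM => //;
      exact: measurable_fun_continuous.
  - by apply/measurable_EFinP; apply: measurable_funM => //;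
      exact: measurable_fun_continuous.
  - apply: ae_imply hh' => t hht; rewrite /= in_itv/= => tT.
    by rewrite hht.
move=> fL gL cf' cg' ff' gg' w phi tphi.
rewrite -(key _ _ _ fL cf' _ ff'); last by case: tphi.
rewrite -(key _ _ _ gL cg' _ gg'); last exact: test_function_continuous.
exact: w.
Qed.

(** Integration by parts; the boundary terms vanish because a test function is zero at [0] and at
    [T]. *)
Lemma C1_weak_derivative (f df : R -> R) :
  {within `[0, T], continuous f} -> {within `[0, T], continuous df} ->
  (forall t, 0 < t < T -> is_derive t 1 f (df t)) ->
  weak_derivative T f df.
Proof.
move=> cf cdf fdf phi tphi; have cphi := test_function_continuous tphi.
have [dphi cdphi _] := tphi.
have itg (h p : R -> R) : {within `[0, T], continuous h} -> continuous p ->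
    mu.-integrable `[0, T] (EFin \o (fun t => h t * p t)).
  move=> ch cp; apply: continuous_compact_integrable; first exact: segment_compact.
  by move=> t; apply: continuousM; [exact: ch|exact: (continuous_subspaceT cp)].
rewrite !Rintegral_oo_cc; [|exact: itg..].
have LR (h : R -> R) : {within `[0, T], continuous h} ->
    (forall t, 0 < t < T -> derivable h t 1) -> derivable_oo_LRcontinuous h 0 T.
  move=> /continuous_within_itvP-/(_ T0)[_ h0 hT] hd; split => //.
have f'E : {in `]0, T[, derive1 f =1 df}.
  by move=> t; rewrite in_itv/= => /fdf h; rewrite derive1E derive_val.
have LRf : derivable_oo_LRcontinuous f 0 T by apply: LR => // t /fdf[].
have LRphi : derivable_oo_LRcontinuous phi 0 T.
  by apply: LR; [exact: continuous_subspaceT|move=> t _; exact: dphi].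
have c1 : {within `[0, T], continuous (derive1 phi)}.
  exact: continuous_subspaceT.
have phi'E : {in `]0, T[, derive1 phi =1 derive1 phi} by [].
have -> := Rintegration_by_parts T0 cdf LRf f'E c1 LRphi phi'E.
by rewrite !(test_function_out tphi) ?ltxx ?andbF// !mulr0 subrr sub0r.
Qed.

End WeakDerivatives.

(** * Du Bois-Reymond's lemma *)

Section DuBoisReymond.
Context {R : realType} (T : R) (T0 : 0 < T).
Local Notation mu := (@lebesgue_measure R).
Local Notation D := (`]0, T[%classic : set R).

Lemma is_derive_global_continuous (f df : R -> R) :
  (forall t : R, is_derive t 1 f (df t)) -> continuous f.
Proof. by move=> h t; exact: is_derive1_continuous (h t). Qed.

Lemma derive0_eq (f : R -> R) (a b : R) : a <= b ->
  (forall t, a < t < b -> is_derive t 1 f 0) -> {within `[a, b], continuous f} ->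
  f a = f b.
Proof.
move=> ab f0 cf.
have d0 x : x \in `]a, b[%R -> is_derive x 1 f (cst 0 x).
  by rewrite in_itv/=; exact: f0.
have [c _] := MVT_segment ab d0 cf.
by rewrite mul0r => /eqP; rewrite subr_eq0 => /eqP.
Qed.

Lemma derive_ge0_homo (f df : R -> R) (a b : R) :
  (forall t, a < t < b -> is_derive t 1 f (df t)) ->
  (forall t, a < t < b -> 0 <= df t) -> {within `[a, b], continuous f} ->
  forall x y, a <= x -> x <= y -> y <= b -> f x <= f y.
Proof.
move=> fdf df0 cf x y ax xy yb.
have d1 z : z \in `]a, b[%R -> derivable f z 1.
  by rewrite in_itv/= => /fdf[].
have d2 z : z \in `]a, b[%R -> 0 <= derive1 f z.
  rewrite in_itv/= => zab; rewrite derive1E.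
  by have h := fdf z zab; rewrite derive_val; exact: df0.
apply: (ger0_derive1_le_cc d1 d2 cf) => //.
- by rewrite in_itv/= ax (le_trans xy).
- by rewrite in_itv/= yb (le_trans ax).
Qed.

Lemma Rintegral_derive (f df : R -> R) : continuous df ->
  (forall t : R, is_derive t 1 f (df t)) -> \int[mu]_(t in D) df t = f T - f 0.
Proof.
move=> cdf fdf.
have cf := is_derive_global_continuous fdf.
rewrite Rintegral_oo_cc; last exact: continuous_segment_integrable.
rewrite /Rintegral (@continuous_FTC2 _ df f 0 T)//.
- exact: continuous_subspaceT.
- split => //.
  + by apply: cvg_within_filter; exact: cf.
  + by apply: cvg_within_filter; exact: cf.
- by move=> x _; rewrite derive1E derive_val.
Qed.

(** A primitive of [q] is nondecreasing with equal values at both ends, hence constant, and its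
    derivative [q] is zero. *)
Lemma Rintegral_eq0 (q : R -> R) : continuous q -> (forall t, 0 <= q t) ->
  \int[mu]_(t in D) q t = 0 -> forall t, 0 < t < T -> q t = 0.
Proof.
move=> cq q0; have [Z _ dZ] := continuous_primitive cq.
have cZ := is_derive_global_continuous dZ.
rewrite (Rintegral_derive cq dZ) => /eqP; rewrite subr_eq0 => /eqP ZT t /andP[t0 tT].
have Zle := @derive_ge0_homo Z q 0 T (fun t _ => dZ t) (fun t _ => q0 t)
  (continuous_subspaceT cZ).
have Zcst x : x \in `]0, T[ -> Z x = Z 0.
  rewrite in_itv/= => /andP[/ltW x0 /ltW xT]; apply/eqP; rewrite eq_le.
  by rewrite -{1}ZT !Zle.
have d0 : is_derive t 1 Z 0.
  have : is_derive t 1 (cst (Z 0)) (0 : R) by exact: is_derive_cst.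
  apply: near_eq_is_derive.
  near=> x; apply/esym/Zcst; near: x; apply: near_in_itvoo.
  by rewrite in_itv/= t0.
have [_ <-] := dZ t; by have [_ ->] := d0.
Unshelve. all: by end_near. Qed.

(* The test function is a primitive of [eta * (h - c)], where [eta] is a bump
   on [[a, b]] and [c] is the [eta]-mean of [h]; testing [h - c] against its
   derivative gives [eta * (h - c) ^+ 2 = 0]. *)
Lemma weak_derivative0_cst (h : R -> R) : continuous h ->
  weak_derivative T h (cst 0) ->
  forall s t, 0 < s < T -> 0 < t < T -> h s = h t.
Proof.
move=> ch wh s t /andP[s0 sT] /andP[t0 tT].
(* Chosen so that [[a, b]] lies inside []0, T[] and contains [s] and [t] in its interior. *)
pose a := Num.min s t / 2; pose b := (Num.max s t + T) / 2.
have m0 : 0 < Num.min s t by rewrite lt_min s0 t0.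
have ms : Num.min s t <= s by rewrite ge_min lexx.
have mt : Num.min s t <= t by rewrite ge_min lexx orbT.
have Ms : s <= Num.max s t by rewrite le_max lexx.
have Mt : t <= Num.max s t by rewrite le_max lexx orbT.
have MT : Num.max s t < T by rewrite gt_max sT tT.
have a0 : 0 < a by rewrite /a; lra.
have bT : b < T by rewrite /b; lra.
have as_ : a < s by rewrite /a; lra.
have at_ : a < t by rewrite /a; lra.
have sb : s < b by rewrite /b; lra.
have tb : t < b by rewrite /b; lra.
have ab : a < b by lra.
move: a b a0 bT as_ at_ sb tb ab {m0 ms mt Ms Mt MT} => a b a0 bT as_ at_ sb tb ab.
(* A merely continuous bump suffices: test functions are asked to be C^1, and [phi] is a
   primitive. *)
pose eta x := Num.max 0 ((x - a) * (b - x)).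
have ceta : continuous eta.
  apply: maxr_continuous; first exact: cst_continuous.
  move=> x; apply: cvgM; apply: cvgB;
    [exact: cvg_id|exact: cvg_cst|exact: cvg_cst|exact: cvg_id].
have eta_ge0 x : 0 <= eta x by rewrite /eta le_max lexx.
have eta_gt0 x : a < x -> x < b -> 0 < eta x.
  by move=> ax xb; rewrite /eta lt_max; apply/orP; right; rewrite mulr_gt0// subr_gt0.
have eta_out x : x <= a \/ b <= x -> eta x = 0.
  by move=> xab; rewrite /eta max_l//; case: xab => ?; nra.
have cetah : continuous (fun x => eta x * h x).
  by move=> x; apply: cvgM; [exact: ceta|exact: ch].
have [V _ dV] := continuous_primitive cetah.
have [W _ dW] := continuous_primitive ceta.
have cW := is_derive_global_continuous dW.
have Wab : W a < W b.
  have [c cab Wc] := @MVT _ W eta a b ab (fun x _ => dW x) (continuous_subspaceT cW).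
  rewrite -subr_gt0 Wc; move: cab; rewrite in_itv/= => /andP[ac cb].
  by rewrite mulr_gt0 ?eta_gt0// subr_gt0.
(* The value for which [phi], zero at [a], also vanishes at [b]; this gives the compact support. *)
pose c := (V b - V a) / (W b - W a).
pose phi x := V x - c * W x - (V a - c * W a).
pose dphi x := eta x * (h x - c).
have dphiE (x : R) : is_derive x 1 phi (dphi x).
  have d1 := dV x; have d2 := dW x.
  apply: is_derive_eq.
  rewrite subr0 /dphi mulrBr; congr (_ - _).
  by rewrite /GRing.scale/= mulrC.
have cphi := is_derive_global_continuous dphiE.
have cdphi : continuous dphi.
  by move=> x; apply: cvgM; [exact: ceta|apply: cvgB; [exact: ch|exact: cvg_cst]].
have phia : phi a = 0 by rewrite /phi subrr.
have phib : phi b = 0.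
  rewrite /phi /c; have : W b - W a != 0 by rewrite subr_eq0 gt_eqF.
  by move=> w; field.
have phi_out x : x <= a \/ b <= x -> phi x = 0.
  have dz y : y <= a \/ b <= y -> is_derive y 1 phi 0.
    by move=> /eta_out e; have := dphiE y; rewrite /dphi e mul0r.
  case=> xab.
  - rewrite -phia; apply: derive0_eq => //; last exact: continuous_subspaceT.
    by move=> y /andP[_ /ltW ya]; apply: dz; left.
  - rewrite -phib; apply/esym/derive0_eq => //; last exact: continuous_subspaceT.
    by move=> y /andP[/ltW ya _]; apply: dz; right.
have derE : derive1 phi = dphi.
  by apply/funext => x; rewrite derive1E; have [_ ->] := dphiE x.
have tphi : test_function T phi.
  split.
  - by move=> x; have [] := dphiE x.
  - by rewrite derE.
  - exists `[a, b]%classic; split; first exact: segment_compact.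
    + by move=> x; rewrite /= !in_itv/= => /andP[ax xb]; apply/andP; split; lra.
    + move=> x; rewrite /= in_itv/= => /negP; rewrite negb_and -!ltNge => xab.
      by apply: phi_out; case/orP: xab => /ltW; [left|right].
have I1 := wh phi tphi.
have I2 : \int[mu]_(x in D) dphi x = 0.
  by rewrite (Rintegral_derive cdphi dphiE) !phi_out ?subrr//; [left|right]; lra.
have I0 : \int[mu]_(x in D) (cst 0 x * phi x) = 0.
  under eq_Rintegral do rewrite mul0r.
  by rewrite Rintegral_cst ?mul0r//; exact: measurable_oo.
have cq : continuous (fun x => (h x - c) * dphi x).
  by move=> x; apply: cvgM; [apply: cvgB; [exact: ch|exact: cvg_cst]|exact: cdphi].
have chd : continuous (fun x => h x * dphi x).
  by move=> x; apply: cvgM; [exact: ch|exact: cdphi].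
have I3 : \int[mu]_(x in D) ((h x - c) * dphi x) = 0.
  under eq_Rintegral do rewrite mulrBl.
  rewrite RintegralB; last 3 first.
  - exact: measurable_oo.
  - exact: continuous_integrable_oo.
  - apply: continuous_integrable_oo.
    by move=> x; apply: cvgM; [exact: cvg_cst|exact: cdphi].
  rewrite RintegralZl ?I2 ?mulr0 ?subr0; last 2 first.
  - exact: measurable_oo.
  - exact: continuous_integrable_oo.
  by move: I1; rewrite derE I0 oppr0.
have q_ge0 x : 0 <= (h x - c) * dphi x.
  by rewrite /dphi mulrCA -expr2 mulr_ge0// sqr_ge0.
have hc x : a < x -> x < b -> h x = c.
  move=> ax xb.
  have := Rintegral_eq0 cq q_ge0 I3; move=> /(_ x) q.
  have /eqP : (h x - c) * dphi x = 0 by apply: q; apply/andP; split; lra.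
  rewrite /dphi !mulf_eq0 (gt_eqF (eta_gt0 _ ax xb))/= orbb subr_eq0.
  by move/eqP.
by rewrite !hc.
Qed.

(** Subtracting a classical primitive [K] of [k] leaves a continuous function with zero weak
    derivative, so near [t] the function [g] is [K] plus a constant. *)
Lemma weak_derivative_is_derive (g k : R -> R) :
  continuous g -> continuous k -> weak_derivative T g k ->
  forall t, 0 < t < T -> is_derive t 1 g (k t).
Proof.
move=> cg ck wg t /andP[t0 tT].
have [K _ dK] := continuous_primitive ck.
have cK := is_derive_global_continuous dK.
have wK : weak_derivative T K k.
  by apply: C1_weak_derivative => //; exact: continuous_subspaceT.
have w0 : weak_derivative T (fun x => g x - K x) (cst 0).
  move=> phi tphi; have cphi := test_function_continuous tphi.
  have [_ cdphi _] := tphi.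
  under eq_Rintegral do rewrite mulrBl.
  rewrite RintegralB; last 3 first.
  - exact: measurable_oo.
  - apply: continuous_integrable_oo => x; apply: cvgM; [exact: cg|exact: cdphi].
  - apply: continuous_integrable_oo => x; apply: cvgM; [exact: cK|exact: cdphi].
  rewrite wg// wK// subrr.
  under eq_Rintegral do rewrite mul0r.
  by rewrite Rintegral_cst ?mul0r ?oppr0//; exact: measurable_oo.
have cgK : continuous (fun x => g x - K x).
  by move=> x; apply: cvgB; [exact: cg|exact: cK].
have : is_derive t 1 (fun x => K x + (g t - K t)) (k t).
  by have d := dK t; apply: is_derive_eq; rewrite addr0.
apply: near_eq_is_derive.
  near=> x; rewrite -(@weak_derivative0_cst _ cgK w0 x t) ?t0//.
    by rewrite addrC subrK.
  by near: x; apply: near_in_itvoo; rewrite in_itv/= t0.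
Unshelve. all: by end_near. Qed.

End DuBoisReymond.

(** * Linear differential equations *)

Section LinearODE.
Context {R : realType}.

Definition mx_is_derive {p q : nat} (F : R -> 'M[R]_(p, q)) (t : R)
    (dF : 'M[R]_(p, q)) :=
  forall i j, is_derive t 1 (fun s => F s i j) (dF i j).

Lemma is_derive_sumr (I : finType) (h : I -> R -> R) (t : R) (dh : I -> R) :
  (forall i, is_derive t 1 (h i) (dh i)) ->
  is_derive t 1 (fun s => \sum_i h i s) (\sum_i dh i).
Proof.
move=> hd; rewrite -fct_sumE.
by elim/big_ind2 : _ => // [|f df g dg ? ?]; [exact: is_derive_cst|exact: is_deriveD].
Qed.

Lemma mx_is_deriveM p q r (F : R -> 'M[R]_(p, q)) (G : R -> 'M[R]_(q, r))
    (t : R) dF dG :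
  mx_is_derive F t dF -> mx_is_derive G t dG ->
  mx_is_derive (fun s => F s *m G s) t (dF *m G t + F t *m dG).
Proof.
move=> hF hG i j.
under eq_fun do rewrite mxE.
rewrite mxE [X in X + _]mxE [X in _ + X]mxE -big_split /=.
apply: is_derive_sumr => l; have h1 := hF i l; have h2 := hG l j.
apply: is_derive_eq.
by rewrite /GRing.scale/= addrC (mulrC (G t l j)).
Qed.

(** Coefficients of the series of [M ^+ p] times the exponential of [t M]. The shift [p] keeps the
    family closed under termwise differentiation, which raises [p] by one. *)
Definition expmx_coeff {k} (M : 'M[R]_k) (p : nat) (i j : 'I_k) (n : nat) : R :=
  (M ^+ (p + n)) i j / n`!%:R.

(** The sum over all entries dominates every row sum, so each multiplication by [M] costs at most
    one such factor. *)
Lemma expmx_pow_bound k (M : 'M[R]_k) n i j :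
  `|(M ^+ n) i j| <= (\sum_a \sum_b `|M a b|) ^+ n.
Proof.
set C := \sum_a \sum_b _.
have rowC a : \sum_b `|M a b| <= C.
  rewrite /C [leRHS](bigD1 a)//= lerDl.
  by apply: sumr_ge0 => ? _; apply: sumr_ge0.
elim: n i j => [|n IH] i j.
  by rewrite !expr0 mxE; case: eqP => _; rewrite ?mulr1n ?mulr0n ?normr1 ?normr0.
rewrite !exprS mxE; apply: le_trans (ler_norm_sum _ _ _) _.
apply: (@le_trans _ _ (\sum_l `|M i l| * C ^+ n)).
  by apply: ler_sum => l _; rewrite normrM ler_wpM2l.
rewrite -mulr_suml; apply: ler_wpM2r; last exact: rowC.
by apply: exprn_ge0; apply: sumr_ge0 => ? _; apply: sumr_ge0.
Qed.

(** Domination by [C ^+ p] times the scalar exponential series at [C * |t|]. *)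
Lemma is_cvg_expmx k (M : 'M[R]_k) p i j (t : R) :
  cvgn (pseries (expmx_coeff M p i j) t).
Proof.
set C := \sum_a \sum_b `|M a b|.
have C0 : 0 <= C by apply: sumr_ge0 => ? _; apply: sumr_ge0.
apply: normed_cvg.
apply: (@series_le_cvg _ _ (fun n => C ^+ p * exp_coeff (C * `|t|) n)) => //.
- by move=> n /=; exact: normr_ge0.
- move=> n; apply: mulr_ge0; first exact: exprn_ge0.
  by rewrite /exp_coeff/= divr_ge0// exprn_ge0// mulr_ge0.
- move=> n; rewrite /expmx_coeff /exp_coeff/= normrM normrX normrM.
  rewrite exprMn mulrA mulrA -exprD normfV [`|n`!%:R|]ger0_norm//.
  rewrite mulrAC ler_wpM2r ?invr_ge0// ler_wpM2r ?exprn_ge0//.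
  exact: expmx_pow_bound.
- rewrite -[X in cvgn X]/(series (C ^+ p *: exp_coeff (C * `|t|))).
  exact/is_cvg_seriesZ/is_cvg_series_exp_coeff.
Qed.

Definition expmx_deriv {k} (M : 'M[R]_k) (p : nat) (t : R) : 'M[R]_k :=
  \matrix_(i, j) limn (pseries (expmx_coeff M p i j) t).

Local Notation expmx M := (expmx_deriv M 0).

Lemma expmx_diffs k (M : 'M[R]_k) p i j :
  pseries_diffs (expmx_coeff M p i j) = expmx_coeff M p.+1 i j.
Proof.
apply/funext => n; rewrite /pseries_diffs /expmx_coeff factS natrM invfM.
by rewrite addnS addSn mulrCA mulVKf.
Qed.

Lemma expmx_is_derive k (M : 'M[R]_k) t :
  mx_is_derive (expmx M) t (expmx_deriv M 1 t).
Proof.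
move=> i j; rewrite mxE; under eq_fun do rewrite mxE.
rewrite -expmx_diffs; apply: (@pseries_snd_diffs _ _ (`|t| + 1)).
- exact: is_cvg_expmx.
- by rewrite expmx_diffs; exact: is_cvg_expmx.
- by rewrite !expmx_diffs; exact: is_cvg_expmx.
- by rewrite [ltRHS]ger0_norm ?ltrDl// addr_ge0.
Qed.

Lemma expmx_deriv1l k (M : 'M[R]_k) t : expmx_deriv M 1 t = M *m expmx M t.
Proof.
apply/matrixP => i j; rewrite !mxE; apply: cvg_lim => //.
under [X in _ --> X]eq_bigr do rewrite mxE.
have -> : pseries (expmx_coeff M 1 i j) t =
    (fun n => \sum_l M i l * pseries (expmx_coeff M 0 l j) t n).
  apply/funext => n; rewrite /pseries /series /=.
  under [RHS]eq_bigr do rewrite mulr_sumr.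
  rewrite exchange_big /=; apply: eq_bigr => a _.
  rewrite /expmx_coeff add1n add0n exprS mxE mulr_suml mulr_suml.
  by apply: eq_bigr => l _; rewrite !mulrA.
apply: cvg_sumr => l _; apply: cvgM; first exact: cvg_cst.
exact: is_cvg_expmx.
Qed.

(** With [M] available on this side too, the two terms in the derivative of
    [expmx M s *m expmx M (- s)] cancel. *)
Lemma expmx_deriv1r k (M : 'M[R]_k) t : expmx_deriv M 1 t = expmx M t *m M.
Proof.
apply/matrixP => i j; rewrite !mxE; apply: cvg_lim => //.
under [X in _ --> X]eq_bigr do rewrite mxE.
have -> : pseries (expmx_coeff M 1 i j) t =
    (fun n => \sum_l pseries (expmx_coeff M 0 i l) t n * M l j).
  apply/funext => n; rewrite /pseries /series /=.
  under [RHS]eq_bigr do rewrite mulr_suml.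
  rewrite exchange_big /=; apply: eq_bigr => a _.
  rewrite /expmx_coeff add1n add0n exprSr mxE mulr_suml mulr_suml.
  by apply: eq_bigr => l _; ring.
apply: cvg_sumr => l _; apply: cvgM; last exact: cvg_cst.
exact: is_cvg_expmx.
Qed.

Lemma expmx0 k (M : 'M[R]_k) : expmx M 0 = 1%:M.
Proof.
apply/matrixP => i j; rewrite mxE; apply: cvg_lim => //.
rewrite -cvg_shiftS; apply: cvg_near_cst; apply: nearW => n /=.
rewrite /pseries /series /= big_nat_recl//= big1.
  by rewrite addr0 /expmx_coeff addn0 expr0 fact0 divr1 mulr1.
by move=> a _; rewrite expr0n mulr0.
Qed.

Lemma mx_is_derive_oppr p q (F : R -> 'M[R]_(p, q)) dF (t : R) :
  mx_is_derive F (- t) dF -> mx_is_derive (fun s => F (- s)) t (- dF).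
Proof.
move=> hF i j; rewrite mxE.
have h : is_derive t 1 (@GRing.opp R) (-1) by exact: is_deriveNid.
have := @is_derive1_comp R (fun s => F s i j) -%R t _ _ (hF i j) h.
by rewrite mulrN1.
Qed.

(** The product has zero derivative and equals the identity at [0]. In the variation of constants it
    turns [expmx M (- t) *m b t] back into [b t]. *)
Lemma expmxN k (M : 'M[R]_k) t : expmx M t *m expmx M (- t) = 1%:M.
Proof.
have h (s : R) i j :
    is_derive s 1 (fun s => (expmx M s *m expmx M (- s)) i j) 0.
  have d := mx_is_deriveM (expmx_is_derive M s)
    (mx_is_derive_oppr (expmx_is_derive M (- s))).
  have := d i j; rewrite expmx_deriv1r expmx_deriv1l.
  by rewrite mulmxN mulmxA subrr mxE.
apply/matrixP => i j.
have := @is_derive_0_is_cst _ (fun s => (expmx M s *m expmx M (- s)) i j) t 0.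
move=> /(_ (fun s => h s i j)) ->.
by rewrite oppr0 expmx0 mulmx1.
Qed.

(** Variation of constants: [expmx M t] times the sum of [x0] and the primitive of
    [expmx M (- t) *m b t]. *)
Lemma linear_ode k (M : 'M[R]_k) (b : R -> 'cV[R]_k) (x0 : 'cV[R]_k) :
  (forall i, continuous (fun t => b t i 0)) ->
  exists2 X : R -> 'cV[R]_k, X 0 = x0 &
    forall t, mx_is_derive X t (M *m X t + b t).
Proof.
move=> cb.
have cEb i : continuous (fun t => (expmx M (- t) *m b t) i 0).
  move=> t; under eq_fun do rewrite mxE.
  apply: cvg_sumr => l _; apply: cvgM; last exact: cb.
  exact: is_derive1_continuous (mx_is_derive_oppr (expmx_is_derive M (- t)) i l).
have /choice[Z hZ] : forall i, exists F : R -> R, F 0 = 0 /\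
    forall t : R, is_derive t 1 F ((expmx M (- t) *m b t) i 0).
  by move=> i; have [F F0 dF] := continuous_primitive (cEb i); exists F.
pose z t : 'cV[R]_k := x0 + \col_i Z i t.
exists (fun t => expmx M t *m z t).
  rewrite expmx0 mul1mx /z; apply/colP => i; rewrite !mxE.
  by have [-> _] := hZ i; rewrite addr0.
move=> t.
have dz : mx_is_derive z t (expmx M (- t) *m b t).
  move=> i j; rewrite ord1; have [_ /(_ t) d] := hZ i.
  have -> : (fun s => z s i 0) = cst (x0 i 0) + Z i.
    by apply/funext => s; rewrite /z !mxE.
  by apply: is_derive_eq; rewrite add0r.
have := mx_is_deriveM (expmx_is_derive M t) dz.
by rewrite expmx_deriv1l mulmxA expmxN mul1mx mulmxA.
Qed.

(** In [L], the part [2 * C * k] comes from [2 v^T M v <= 2 C k |v|^2] and the 1 from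
    [2 d^T f <= |d|^2 + |f|^2]. With this [L], [expR (- L * s) * sqn (d s) - e * s] is
    nonincreasing, the forcing contributing at most [e] because the exponential factor is at most
    1. *)
Lemma gronwall k (M : 'M[R]_k) (d f : R -> 'cV[R]_k) (T C e : R) :
  0 <= T -> (forall i, continuous (fun t => d t i 0)) ->
  (forall t, 0 < t < T -> mx_is_derive d t (M *m d t + f t)) ->
  (forall i j, `|M i j| <= C) ->
  (forall t, 0 < t < T -> sqn (f t) <= e) ->
  let L := 2 * C * k%:R + 1 in
  forall t, 0 <= t <= T -> sqn (d t) <= expR (L * t) * (sqn (d 0) + e * t).
Proof.
move=> T0 cd dd MC fe L t /andP[t0 tT].
have L1 : 1 <= L.
  (* An empty matrix puts no sign on [C], so [k = 0] is treated apart. *)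
  rewrite /L lerDr; case: k M d f cd dd MC fe @L => [|k] M d f cd dd MC fe L.
    by rewrite mulr0.
  by rewrite !mulr_ge0// (le_trans _ (MC ord0 ord0)).
pose q s := expR (- L * s) * sqn (d s) - e * s.
have Mle v : 2 * (v^T *m (M *m v)) 0 0 <= (L - 1) * sqn v.
  rewrite mxE mulr_sumr.
  (* Each term is split symmetrically: [2 v_i M_ij v_j <= C (v_i^2 + v_j^2)]. *)
  apply: (@le_trans _ _ (\sum_i \sum_j C * (v i 0 ^+ 2 + v j 0 ^+ 2))).
    apply: ler_sum => i _; rewrite !mxE !mulr_sumr; apply: ler_sum => j _.
    have h := MC i j; have := sqr_ge0 (v i 0 - v j 0).
    have := sqr_ge0 (v i 0 + v j 0).
    by move: h; rewrite ler_norml => /andP[h1 h2]; nra.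
  rewrite le_eqVlt; apply/orP; left; apply/eqP.
  under eq_bigr do rewrite -mulr_sumr big_split/= sumr_const card_ord.
  rewrite -mulr_sumr big_split/= sumr_const card_ord -/(sqn v).
  rewrite sumrMnl -/(sqn v) /L -mulr_natr; ring.
pose dq s := expR (- L * s) * (2 * ((d s)^T *m (M *m d s + f s)) 0 0)
  - L * expR (- L * s) * sqn (d s) - e.
have dqE s : 0 < s < T -> is_derive s 1 q (dq s).
  move=> sT; rewrite /q /dq.
  have d1 : is_derive s 1 (fun s => sqn (d s))
      (2 * ((d s)^T *m (M *m d s + f s)) 0 0).
    rewrite /sqn [X in 2 * X]mxE mulr_sumr; apply: is_derive_sumr => i.
    have h := dd s sT i 0; apply: is_derive_eq.
    by rewrite [X in 2 * (X * _)]mxE /GRing.scale/=; ring.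
  have dl (a : R) : is_derive s 1 (fun s => a * s) a.
    by have := is_deriveZ a (is_derive_id s (1 : R)); rewrite /GRing.scale/= mulr1.
  have de := @is_derive1_comp R expR (fun s => - L * s) s _ _
    (is_derive_expR _) (dl (- L)).
  apply: is_derive_eq (is_deriveB (is_deriveM de d1) (dl e)) _.
  by rewrite /GRing.scale/=; ring.
have cq : {within `[0, T], continuous q}.
  apply: continuous_subspaceT => s; apply: cvgB; last first.
    by apply: cvgM; [exact: cvg_cst|exact: cvg_id].
  apply: cvgM.
    apply: (@continuous_comp _ _ _ (fun s => - L * s) expR).
      by apply: cvgM; [exact: cvg_cst|exact: cvg_id].
    exact: continuous_expR.
  apply: cvg_sumr => i _; under eq_fun do rewrite expr2.
  by apply: cvgM; exact: cd.
have dq_le0 s : 0 < s < T -> 0 <= - dq s.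
  move=> sT; rewrite oppr_ge0 /dq.
  have h1 := Mle (d s); have h2 : 2 * ((d s)^T *m f s) 0 0 <= sqn (d s) + sqn (f s).
    rewrite mxE mulr_sumr /sqn -big_split/=; apply: ler_sum => i _.
    by rewrite mxE; have := sqr_ge0 (d s i 0 - f s i 0); nra.
  have e0 : 0 <= e by apply: le_trans (fe s sT); exact: sqn_ge0.
  have x1 : expR (- L * s) <= 1.
    have [/ltW s0 _] := andP sT.
    by rewrite -[leRHS]expR0 ler_expR mulNr oppr_le0 mulr_ge0// (le_trans ler01).
  rewrite mulmxDr [X in 2 * X]mxE.
  have := fe s sT; have := expR_ge0 (- L * s).
  move: h1 h2 x1 e0; rewrite -/L; move: (L) => L'.
  set a := ((d s)^T *m (M *m d s)) 0 0; set b := ((d s)^T *m f s) 0 0.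
  move: a b (expR _) (sqn (d s)) (sqn (f s)) => a b x S F h1 h2 x1 e0 x0 Fe.
  have : x * (2 * (a + b)) <= x * (L' * S + e) by apply: ler_wpM2l => //; lra.
  have : x * e <= e by rewrite ler_piMl.
  lra.
have dqN s : 0 < s < T -> is_derive s 1 (- q) (- dq s).
  by move=> sT; have h := dqE s sT; exact: is_deriveN.
have cqN : {within `[0, T], continuous (- q)}.
  by move=> s; apply: cvgN; exact: cq.
have := @derive_ge0_homo R (- q) (fun s => - dq s) 0 T dqN dq_le0 cqN 0 t
  (lexx 0) t0 tT.
rewrite lerN2.
rewrite /q !mulr0 expR0 mul1r subr0 mulNr expRN.
rewrite lerBlDr mulrC ler_pdivrMr ?expR_gt0// mulrC => /le_trans; apply.
by [].
Qed.

End LinearODE.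

(** * Elimination of the algebraic variables *)

Section Reduction.
Context {R : realType} {r s m : nat}.
Implicit Types w : param R r s m.

Definition sysmx w : 'M[R]_(r + s) := pJ w - pR w.
Definition algmx w : 'M[R]_s := drsubmx (sysmx w).
(** The Schur complement of [algmx w]. This formula and the following ones result from solving the
    algebraic rows [A21 x1 + A22 x2 + B2 u = 0] for [x2] and substituting into the differential rows
    and into the output. *)
Definition odeA w : 'M[R]_r :=
  ulsubmx (sysmx w) - ursubmx (sysmx w) *m invmx (algmx w) *m dlsubmx (sysmx w).
Definition odeB w : 'M[R]_(r, m) :=
  usubmx (pB w) - ursubmx (sysmx w) *m invmx (algmx w) *m dsubmx (pB w).
Definition algA w : 'M[R]_(s, r) := - (invmx (algmx w) *m dlsubmx (sysmx w)).
Definition algB w : 'M[R]_(s, m) := - (invmx (algmx w) *m dsubmx (pB w)).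
Definition fullstate w (x1 : 'cV[R]_r) (v : 'cV[R]_m) : 'cV[R]_(r + s) :=
  col_mx x1 (algA w *m x1 + algB w *m v).
Definition outA w : 'M[R]_(m, r) := (usubmx (pB w))^T + (dsubmx (pB w))^T *m algA w.
Definition outB w : 'M[R]_m := (dsubmx (pB w))^T *m algB w.

Lemma Uad_coercive eps w : 0 < eps -> Uad r s m eps w ->
  forall v, eps ^+ 2 * sqn v <= sqn (algmx w *m v).
Proof.
move=> eps0 [_ _ h]; have e : algmx w = drsubmx (pJ w) - drsubmx (pR w).
  by apply/matrixP => i j; rewrite !mxE.
by apply/(le_sigma_min _ eps0); rewrite e.
Qed.

(** [Emx] kills the lower rows of [dx], which leaves a linear system for the algebraic part. One
    direction builds state solutions; the other reads the reduced equation off a weak solution,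
    pointwise in time. *)
Lemma dae_reduction w (dx x : 'cV[R]_(r + s)) (v : 'cV[R]_m) :
  algmx w \in unitmx ->
  Emx r s *m dx = sysmx w *m x + pB w *m v <->
  x = fullstate w (usubmx x) v /\
  usubmx dx = odeA w *m usubmx x + odeB w *m v.
Proof.
move=> u22.
have inj22 (y z : 'cV[R]_s) : algmx w *m y = algmx w *m z -> y = z.
  by move=> e; rewrite -(mulKmx u22 y) e mulKmx.
rewrite -{1}(vsubmxK dx) -{1 2}(vsubmxK x) -{1}(submxK (sysmx w)).
rewrite -{1}(vsubmxK (pB w)) /Emx.
rewrite !mul_block_col !mul_col_mx !add_col_mx !mul0mx !mul1mx !addr0 -/(algmx w).
move: (usubmx dx) (usubmx x) (dsubmx x) => d x1 x2.
rewrite /fullstate /odeA /odeB /algA /algB !mulmxBl.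
set A11 := ulsubmx _; set A12 := ursubmx _; set A21 := dlsubmx _.
set B1 := usubmx _; set B2 := dsubmx _.
have ex2 y : A21 *m x1 + algmx w *m y + B2 *m v = 0 <->
    y = - (invmx (algmx w) *m A21) *m x1 + - (invmx (algmx w) *m B2) *m v.
  split=> [e|->].
    apply: inj22; rewrite mulmxDr !mulmxA !mulmxN !mulmxA !mulmxV// !mul1mx !mulNmx.
    rewrite -opprD; apply/eqP; rewrite -subr_eq0 opprK -e; apply/eqP.
    by rewrite addrCA addrA.
  rewrite mulmxDr !mulmxA !mulmxN !mulmxA !mulmxV// !mul1mx !mulNmx.
  by rewrite addrA subrr sub0r addNr.
split.
- move=> /eq_col_mx[e1 /esym/ex2 e2]; split; first by rewrite -e2.
  rewrite e1 e2 mulmxDr !mulNmx !mulmxN !mulmxA.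
  by rewrite -!addrA; congr (_ + (_ + _)); rewrite addrC.
- move=> [/eq_col_mx[_ e2] e1]; congr col_mx; last by apply/esym/ex2.
  rewrite e1 e2 mulmxDr !mulNmx !mulmxN !mulmxA.
  by rewrite -!addrA; congr (_ + (_ + _)); rewrite addrC.
Qed.

Lemma output_fullstate w x1 v :
  (pB w)^T *m fullstate w x1 v = outA w *m x1 + outB w *m v.
Proof.
rewrite -{1}(vsubmxK (pB w)) tr_col_mx mul_row_col /outA /outB.
by rewrite mulmxDr mulmxDl !mulmxA addrA.
Qed.

End Reduction.

(** * The state equation *)

Section MatrixContinuity.
Context {R : realType}.

Definition mx_continuous {p q} (F : R -> 'M[R]_(p, q)) :=
  forall i j, continuous (fun t => F t i j).

Lemma mx_continuous_cst p q (A : 'M[R]_(p, q)) : mx_continuous (fun=> A).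
Proof. by move=> i j; exact: cst_continuous. Qed.

Lemma mx_continuousD p q (F G : R -> 'M[R]_(p, q)) :
  mx_continuous F -> mx_continuous G -> mx_continuous (fun t => F t + G t).
Proof.
move=> cF cG i j t; under eq_fun do rewrite mxE.
by apply: cvgD; [exact: cF|exact: cG].
Qed.

Lemma mx_continuousM p q k (F : R -> 'M[R]_(p, q)) (G : R -> 'M[R]_(q, k)) :
  mx_continuous F -> mx_continuous G -> mx_continuous (fun t => F t *m G t).
Proof.
move=> cF cG i j t; under eq_fun do rewrite mxE.
by apply: cvg_sumr => l _; apply: cvgM; [exact: cF|exact: cG].
Qed.

Lemma mx_is_derive_cst p q (A : 'M[R]_(p, q)) t : mx_is_derive (fun=> A) t 0.
Proof. by move=> i j; rewrite mxE; exact: is_derive_cst. Qed.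

Lemma mx_is_deriveD p q (F G : R -> 'M[R]_(p, q)) t dF dG :
  mx_is_derive F t dF -> mx_is_derive G t dG ->
  mx_is_derive (fun s => F s + G s) t (dF + dG).
Proof.
move=> hF hG i j; rewrite mxE.
have -> : (fun s => (F s + G s) i j) = (fun s => F s i j) + (fun s => G s i j).
  by apply/funext => s; rewrite mxE.
by apply: is_deriveD; [exact: hF|exact: hG].
Qed.

Lemma mx_is_derive_mull p q k (A : 'M[R]_(p, q)) (F : R -> 'M[R]_(q, k)) t dF :
  mx_is_derive F t dF -> mx_is_derive (fun s => A *m F s) t (A *m dF).
Proof.
move=> hF; have := mx_is_deriveM (@mx_is_derive_cst _ _ A t) hF.
by rewrite mul0mx add0r.
Qed.

End MatrixContinuity.

Section StateEquation.
Context {R : realType} {r s m : nat} (T : R) (T0 : 0 < T).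
Variables (u : R -> 'cV[R]_m) (hu : C1_closed_vec T u).
Local Notation mu := (@lebesgue_measure R).
Implicit Types w : param R r s m.

Definition clamped t := u (clamp T t).

Lemma clamped_id t : 0 <= t <= T -> clamped t = u t.
Proof. by move=> tT; rewrite /clamped clamp_id. Qed.

Lemma clamped_continuous : mx_continuous clamped.
Proof.
move=> i j; rewrite ord1; have [cu _] := hu i.
exact: continuous_clamp T0 _ cu.
Qed.

Lemma near_oo (t : R) : 0 < t < T -> \forall x \near t, 0 < x < T.
Proof.
move=> tT; near=> x.
have : x \in `]0, T[ by near: x; apply: near_in_itvoo; rewrite in_itv.
by rewrite in_itv.
Unshelve. all: by end_near. Qed.

(** Restricted to the open interval because the clamped input may have corners at [0] and [T]. *)
Lemma clamped_is_derive : exists2 du : R -> 'cV[R]_m, mx_continuous du &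
  forall t, 0 < t < T -> mx_is_derive clamped t (du t).
Proof.
have /choice[v hv] : forall i, exists v : R -> R,
    {within `[0, T], continuous v} /\
    forall t, 0 < t < T -> is_derive t 1 (fun t => u t i 0) (v t).
  by move=> i; have [_ [v cv dv]] := hu i; exists v.
exists (fun t => \col_i v i (clamp T t)).
  move=> i j; under eq_fun do rewrite mxE.
  by have [cv _] := hv i; exact: continuous_clamp T0 _ cv.
move=> t tT i j; rewrite mxE ord1; have [_ /(_ t tT)] := hv i.
have [t0 t1] := andP tT; rewrite clamp_id ?(ltW t0) ?(ltW t1)//.
apply: near_eq_is_derive; near=> x.
have /andP[x0 xT] : 0 < x < T by near: x; exact: near_oo.
by rewrite clamped_id// (ltW x0) (ltW xT).
Unshelve. all: by end_near. Qed.

(** The equation is asked on the open interval only, so that the clamped representative of a weak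
    solution, constant beyond the endpoints, qualifies as well. *)
Definition ode_solution w (X : R -> 'cV[R]_r) : Prop :=
  [/\ X 0 = px0 w, mx_continuous X
    & forall t, 0 < t < T ->
      mx_is_derive X t (odeA w *m X t + odeB w *m clamped t)].

Lemma ode_solution_exists w : exists X, ode_solution w X.
Proof.
have cb i : continuous (fun t => (odeB w *m clamped t) i 0).
  by apply: (@mx_continuousM _ _ _ _ (fun=> odeB w) clamped);
    [exact: mx_continuous_cst|exact: clamped_continuous].
have [X X0 dX] := linear_ode (odeA w) (px0 w) cb.
exists X; split => // i j t.
exact: is_derive1_continuous (dX t i j).
Qed.

Lemma H1_vec_C1 k (F dF : R -> 'cV[R]_k) :
  mx_continuous F -> mx_continuous dF ->
  (forall t, 0 < t < T -> mx_is_derive F t (dF t)) ->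
  [/\ H1_vec T F, L2_vec T dF & weak_derivative_vec T F dF].
Proof.
move=> cF cdF hF.
have L i : L2 T (fun t => dF t i 0) by exact: continuous_L2.
have W i : weak_derivative T (fun t => F t i 0) (fun t => dF t i 0).
  apply: C1_weak_derivative => //; try exact: continuous_subspaceT.
  by move=> t /hF.
split => // i; split; first exact: continuous_L2.
by exists (fun t => dF t i 0).
Qed.

(** General [A] and [B], since the full state and the output both have this shape. *)
Lemma ode_solution_H1 w k (A : 'M[R]_(k, r)) (B : 'M[R]_(k, m)) X :
  ode_solution w X -> exists2 dy : R -> 'cV[R]_k,
  [/\ H1_vec T (fun t => A *m X t + B *m clamped t), L2_vec T dy
    & weak_derivative_vec T (fun t => A *m X t + B *m clamped t) dy]
  & forall t, 0 < t < T ->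
      mx_is_derive (fun t => A *m X t + B *m clamped t) t (dy t).
Proof.
move=> [_ cX dX]; have [du cdu hdu] := clamped_is_derive.
pose dy t := A *m (odeA w *m X t + odeB w *m clamped t) + B *m du t.
have d t : 0 < t < T -> mx_is_derive (fun t => A *m X t + B *m clamped t) t (dy t).
  by move=> tT; apply: mx_is_deriveD; apply: mx_is_derive_mull; [exact: dX|exact: hdu].
exists dy => //; apply: H1_vec_C1 => //.
- by apply: mx_continuousD; apply: mx_continuousM;
    do ?[exact: mx_continuous_cst | exact: cX | exact: clamped_continuous].
- apply: mx_continuousD; apply: mx_continuousM; do ?exact: mx_continuous_cst; last exact: cdu.
  by apply: mx_continuousD; apply: mx_continuousM;
    do ?[exact: mx_continuous_cst | exact: cX | exact: clamped_continuous].
Qed.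

Lemma ode_state_solution w X : algmx w \in unitmx -> ode_solution w X ->
  state_solution T u w (fun t => fullstate w (X t) (clamped t)).
Proof.
move=> u22 hX; have [X0 cX dX] := hX.
have fsE t : fullstate w (X t) (clamped t) =
    col_mx 1%:M (algA w) *m X t + col_mx 0 (algB w) *m clamped t.
  by rewrite /fullstate !mul_col_mx add_col_mx mul1mx mul0mx addr0.
have [dx [H L W] dxE] := ode_solution_H1 (col_mx 1%:M (algA w)) (col_mx 0 (algB w)) hX.
have fsE' : (fun t => fullstate w (X t) (clamped t)) =
    (fun t => col_mx 1%:M (algA w) *m X t + col_mx 0 (algB w) *m clamped t).
  by apply/funext.
rewrite fsE'; split => //.
- exists dx; split => //; apply: (@aeW _ _ _ mu) => t tT.
  have [t0 t1] := andP tT.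
  rewrite -fsE -(@clamped_id t); last by rewrite (ltW t0) (ltW t1).
  apply/dae_reduction => //; rewrite /fullstate col_mxKu; split => //.
  apply/colP => i; rewrite mxE.
  have d1 := dxE t tT (lshift s i) 0; have d2 := dX t tT i 0.
  have e : (fun t => (col_mx 1%:M (algA w) *m X t + col_mx 0 (algB w) *m clamped t)
      (lshift s i) 0) = (fun t => X t i 0).
    by apply/funext => x; rewrite -fsE /fullstate col_mxEu.
  move: d1; rewrite e => d1.
  by have [_ <-] := d1; have [_ ->] := d2.
- move=> i; exists (fun t => X t i 0); split.
  + exact: continuous_subspaceT.
  + by apply: (@aeW _ _ _ mu) => t _; rewrite -fsE /fullstate col_mxKu.
  + by rewrite X0.
Qed.

(** Gronwall for the difference, with zero forcing and zero initial value. *)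
Lemma ode_solution_unique w X Y t : ode_solution w X -> ode_solution w Y ->
  0 <= t <= T -> X t = Y t.
Proof.
move=> [X0 cX dX] [Y0 cY dY] tT.
pose d t := X t - Y t.
have cd i : continuous (fun t => d t i 0).
  move=> x; rewrite /d; under eq_fun do rewrite !mxE.
  by apply: cvgB; [exact: cX|exact: cY].
have dd x : 0 < x < T -> mx_is_derive d x (odeA w *m d x + (fun=> 0) x).
  move=> xT i j; rewrite addr0 /d mulmxBr.
  have -> : (fun t => (X t - Y t) i j) = (fun t => X t i j) - (fun t => Y t i j).
    by apply/funext => y; rewrite !mxE.
  apply: is_derive_eq (is_deriveB (dX x xT i j) (dY x xT i j)) _.
  by rewrite !mxE; ring.
pose C := \sum_i \sum_j `|odeA w i j|.
have MC i j : `|odeA w i j| <= C.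
  rewrite /C (bigD1 i)//= (bigD1 j)//= -!addrA lerDl.
  by rewrite addr_ge0//; apply: sumr_ge0 => // *; apply: sumr_ge0.
have f0 x : 0 < x < T -> sqn ((fun=> 0 : 'cV[R]_r) x) <= 0 by rewrite sqn0.
have := gronwall (ltW T0) cd dd MC f0 tT.
rewrite mul0r addr0 /d X0 Y0 subrr sqn0 mulr0 => h.
have /sqn_eq0/eqP : sqn (X t - Y t) = 0 by apply/eqP; rewrite eq_le h sqn_ge0.
by rewrite subr_eq0 => /eqP.
Qed.

(** The initial condition itself supplies the continuous representative [G] of the differential
    part. By the reduced equation its weak derivative agrees almost everywhere with a continuous
    function of [G] and [u], so [G] is a classical solution and therefore equals [X]. *)
Lemma state_solution_unique w X x : algmx w \in unitmx -> ode_solution w X ->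
  state_solution T u w x ->
  {ae mu, forall t, 0 < t < T -> x t = fullstate w (X t) (clamped t)}.
Proof.
move=> u22 hX [Hx [dx [Ldx Wdx hdx]] ix].
have /choice[g hg] : forall i, exists g : R -> R,
    [/\ {within `[0, T], continuous g},
        {ae mu, forall t, 0 < t < T -> usubmx (x t) i 0 = g t}
      & g 0 = px0 w i 0] by exact: ix.
pose G t : 'cV[R]_r := \col_i g i (clamp T t).
have cG : mx_continuous G.
  move=> i j; rewrite /G; under eq_fun do rewrite mxE.
  by have [cg _ _] := hg i; exact: continuous_clamp T0 _ cg.
have aeG : {ae mu, forall t, 0 < t < T -> usubmx (x t) = G t}.
  apply: ae_imply (ae_forall (fun i => let: And3 _ h _ := hg i in h)) => t h tT.
  have [t0 t1] := andP tT.
  apply/colP => i; rewrite h// mxE clamp_id// (ltW t0) (ltW t1)//.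
have aeD : {ae mu, forall t, 0 < t < T ->
    x t = fullstate w (G t) (clamped t) /\
    usubmx (dx t) = odeA w *m G t + odeB w *m clamped t}.
  apply: ae_imply (ae_and aeG hdx) => t [h1 h2] tT.
  have [t0 t1] := andP tT; rewrite clamped_id ?(ltW t0) ?(ltW t1)//.
  rewrite -(h1 tT); apply/(dae_reduction _ _ _ u22).
  exact: h2.
have hG : ode_solution w G.
  split => //.
    apply/colP => i; rewrite mxE clamp_id ?lexx ?(ltW T0)//.
    by have [_ _ ->] := hg i.
  move=> t tT i j; rewrite ord1.
  have cdG : mx_continuous (fun t => odeA w *m G t + odeB w *m clamped t).
    by apply: mx_continuousD; apply: mx_continuousM;
      do ?[exact: mx_continuous_cst | exact: cG | exact: clamped_continuous].
  apply: (@weak_derivative_is_derive _ T T0 (fun t => G t i 0)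
    (fun t => (odeA w *m G t + odeB w *m clamped t) i 0)) => //.
  apply: ae_weak_derivative (Wdx (lshift s i)) => //.
  - by have [] := Hx (lshift s i).
  - by apply: ae_imply aeG => y hy /hy <-; rewrite mxE.
  - by apply: ae_imply aeD => y hy /hy[_ <-]; rewrite mxE.
apply: ae_imply aeD => t ht tT; have [t0 t1] := andP tT.
rewrite (ode_solution_unique hX hG); last by rewrite (ltW t0) (ltW t1).
by have [] := ht tT.
Qed.

End StateEquation.

(** * Convergence of matrices and stability *)

Section MatrixConvergence.
Context {R : realType} {I : Type} (F : set_system I) {FF : ProperFilter F}.

(** Entrywise and along any filter, so that each rule below is the scalar one applied to finitely
    many entries. *)
Definition mx_cvg {p q} (A : I -> 'M[R]_(p, q)) (L : 'M[R]_(p, q)) : Prop :=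
  forall i j, A n i j @[n --> F] --> L i j.

Lemma mx_cvg_cst p q (A : 'M[R]_(p, q)) : mx_cvg (fun=> A) A.
Proof. by move=> i j; exact: cvg_cst. Qed.

Lemma mx_cvgD p q (A B : I -> 'M[R]_(p, q)) a b :
  mx_cvg A a -> mx_cvg B b -> mx_cvg (fun n => A n + B n) (a + b).
Proof.
move=> cA cB i j; rewrite mxE; under eq_fun do rewrite mxE.
by apply: cvgD; [exact: cA|exact: cB].
Qed.

Lemma mx_cvgN p q (A : I -> 'M[R]_(p, q)) a :
  mx_cvg A a -> mx_cvg (fun n => - A n) (- a).
Proof.
move=> cA i j; rewrite mxE; under eq_fun do rewrite mxE.
by apply: cvgN; exact: cA.
Qed.

Lemma mx_cvgB p q (A B : I -> 'M[R]_(p, q)) a b :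
  mx_cvg A a -> mx_cvg B b -> mx_cvg (fun n => A n - B n) (a - b).
Proof. by move=> cA cB; apply: mx_cvgD => //; exact: mx_cvgN. Qed.

Lemma mx_cvgM p q k (A : I -> 'M[R]_(p, q)) (B : I -> 'M[R]_(q, k)) a b :
  mx_cvg A a -> mx_cvg B b -> mx_cvg (fun n => A n *m B n) (a *m b).
Proof.
move=> cA cB i j; rewrite mxE; under eq_fun do rewrite mxE.
by apply: cvg_sumr => l _; apply: cvgM; [exact: cA|exact: cB].
Qed.

Lemma mx_cvgT p q (A : I -> 'M[R]_(p, q)) a :
  mx_cvg A a -> mx_cvg (fun n => (A n)^T) a^T.
Proof. by move=> cA i j; rewrite mxE; under eq_fun do rewrite mxE; exact: cA. Qed.

Lemma mx_cvg_usubmx p q k (A : I -> 'M[R]_(p + q, k)) a :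
  mx_cvg A a -> mx_cvg (fun n => usubmx (A n)) (usubmx a).
Proof. by move=> cA i j; rewrite mxE; under eq_fun do rewrite mxE; exact: cA. Qed.

Lemma mx_cvg_dsubmx p q k (A : I -> 'M[R]_(p + q, k)) a :
  mx_cvg A a -> mx_cvg (fun n => dsubmx (A n)) (dsubmx a).
Proof. by move=> cA i j; rewrite mxE; under eq_fun do rewrite mxE; exact: cA. Qed.

Lemma mx_cvg_lsubmx p q k (A : I -> 'M[R]_(k, p + q)) a :
  mx_cvg A a -> mx_cvg (fun n => lsubmx (A n)) (lsubmx a).
Proof. by move=> cA i j; rewrite mxE; under eq_fun do rewrite mxE; exact: cA. Qed.

Lemma mx_cvg_rsubmx p q k (A : I -> 'M[R]_(k, p + q)) a :
  mx_cvg A a -> mx_cvg (fun n => rsubmx (A n)) (rsubmx a).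
Proof. by move=> cA i j; rewrite mxE; under eq_fun do rewrite mxE; exact: cA. Qed.

Lemma mx_cvg_unique p q (A : I -> 'M[R]_(p, q)) a b :
  mx_cvg A a -> mx_cvg A b -> a = b.
Proof.
move=> ca cb; apply/matrixP => i j.
exact: (cvg_unique _ (ca i j) (cb i j)).
Qed.

Lemma cvg_sqn k (v : I -> 'cV[R]_k) l : mx_cvg v l -> sqn (v n) @[n --> F] --> sqn l.
Proof.
move=> cv; apply: cvg_sumr => i _; rewrite expr2; under eq_fun do rewrite expr2.
by apply: cvgM; exact: cv.
Qed.

Definition l1norm {p q} (A : 'M[R]_(p, q)) : R := \sum_i \sum_j `|A i j|.

Lemma l1norm_ge0 p q (A : 'M[R]_(p, q)) : 0 <= l1norm A.
Proof. by apply: sumr_ge0 => *; apply: sumr_ge0. Qed.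

Lemma row_l1norm_le p q (A : 'M[R]_(p, q)) i : \sum_j `|A i j| <= l1norm A.
Proof.
rewrite /l1norm [leRHS](bigD1 i)//= lerDl.
by apply: sumr_ge0 => *; apply: sumr_ge0.
Qed.

Lemma coord_l1norm_le p q (A : 'M[R]_(p, q)) i j : `|A i j| <= l1norm A.
Proof.
apply: le_trans (row_l1norm_le A i).
by rewrite (bigD1 j)//= lerDl sumr_ge0.
Qed.

Lemma mulmx_l1norm_le p q (A : 'M[R]_(p, q)) (v : 'cV[R]_q) K i :
  (forall j, `|v j 0| <= K) -> `|(A *m v) i 0| <= l1norm A * K.
Proof.
(* An empty [v] puts no sign on [K]. *)
move=> vK; have [q0|] := boolP (q == 0)%N.
  move: A v vK; rewrite (eqP q0) => A v vK.
  rewrite mxE big_ord0 normr0 /l1norm big1 ?mul0r// => a _.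
  by rewrite big_ord0.
rewrite -lt0n => q0.
have K0 : 0 <= K by apply: le_trans (vK (Ordinal q0)).
rewrite mxE; apply: le_trans (ler_norm_sum _ _ _) _.
apply: (@le_trans _ _ ((\sum_j `|A i j|) * K)).
  by rewrite mulr_suml; apply: ler_sum => j _; rewrite normrM ler_wpM2l.
by apply: ler_wpM2r => //; exact: row_l1norm_le.
Qed.

Lemma cvg_l1norm p q (A : I -> 'M[R]_(p, q)) a :
  mx_cvg A a -> l1norm (A n) @[n --> F] --> l1norm a.
Proof.
move=> cA; apply: cvg_sumr => i _; apply: cvg_sumr => j _.
by apply: cvg_norm; exact: cA.
Qed.

Lemma cvg_l1normB p q (A : I -> 'M[R]_(p, q)) a :
  mx_cvg A a -> l1norm (A n - a) @[n --> F] --> 0.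
Proof.
move=> cA; have -> : 0 = l1norm (a - a).
  by rewrite subrr /l1norm big1// => i _; rewrite big1// => j _; rewrite mxE normr0.
by apply: cvg_l1norm; apply: mx_cvgB => //; exact: mx_cvg_cst.
Qed.

End MatrixConvergence.

(** * Convergence along ultrafilters *)

Section Ultrafilter.
Context {R : realType} {I : Type} (F : set_system I) {FF : UltraFilter F}.

Lemma fmap_ultra (J : Type) (f : I -> J) : UltraFilter (f @ F).
Proof.
split; first exact: fmap_proper_filter.
move=> G GP FG; apply/seteqP; split => // A GA.
have [//|nA] := in_ultra_setVsetC (f @^-1` A) FF.
have /FG GnA : (f @ F) (~` A) by [].
have : G set0 by rewrite -(setICr A); exact: filterI.
by move/(@filter_not_empty _ G GP).
Qed.

(** The image ultrafilter contains a compact segment, hence converges there. *)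
Lemma ultra_bounded_cvg (f : I -> R) C : (forall n, `|f n| <= C) ->
  exists l : R, f @ F --> l.
Proof.
move=> fC; have := @segment_compact R (- C) C; rewrite compact_ultra.
move=> /(_ (f @ F) (fmap_ultra f)) [|l [_ fl]].
  have -> : (f @ F) `[- C, C]%classic = F setT.
    congr F; apply/seteqP; split => // n _.
    by rewrite /= in_itv/= -ler_norml.
  exact: filterT.
by exists l.
Qed.

Lemma ultra_mx_cvg p q (A : I -> 'M[R]_(p, q)) C :
  (forall n i j, `|A n i j| <= C) -> exists L, mx_cvg F A L.
Proof.
move=> AC; have /choice[l hl] : forall ij : 'I_p * 'I_q, exists l : R,
    A n ij.1 ij.2 @[n --> F] --> l.
  by move=> ij; apply: ultra_bounded_cvg => n; exact: AC.
exists (\matrix_(i, j) l (i, j)) => i j; rewrite mxE.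
exact: (hl (i, j)).
Qed.

(* The inverses are bounded by [eps^-1], hence converge along the ultrafilter,
   and their limit can only be the inverse of the limit. *)
Lemma invmx_cvg k (A : I -> 'M[R]_k) a eps : 0 < eps ->
  (forall n v, eps ^+ 2 * sqn v <= sqn (A n *m v)) -> mx_cvg F A a ->
  mx_cvg F (fun n => invmx (A n)) (invmx a).
Proof.
move=> eps0 h cA.
have [L cL] : exists L, mx_cvg F (fun n => invmx (A n)) L.
  by apply: (@ultra_mx_cvg _ _ _ eps^-1) => n i j; exact: coercive_invmx_bound.
have aL : a *m L = 1%:M.
  apply: (mx_cvg_unique (mx_cvgM cA cL)).
  have -> : (fun n => A n *m invmx (A n)) = fun=> 1%:M.
    by apply/funext => n; rewrite mulmxV// (coercive_unitmx eps0 (h n)).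
  exact: mx_cvg_cst.
have [au _] := mulmx1_unit aL.
by rewrite -[invmx a]mulmx1 -aL mulKmx.
Qed.

End Ultrafilter.

(** * Uniform stability of the output under perturbation of the parameters *)

Section StateStability.
Context {R : realType} {r s m : nat} (T : R) (T0 : 0 < T).
Variables (u : R -> 'cV[R]_m) (hu : C1_closed_vec T u).
Context {I : Type} (F : set_system I) {FF : ProperFilter F}.
Implicit Types w : param R r s m.

Lemma mx_continuous_bounded p (X : R -> 'cV[R]_p) : mx_continuous X ->
  exists2 K, 0 <= K & forall t, 0 <= t <= T -> forall i, `|X t i 0| <= K.
Proof.
move=> cX.
have /choice[K hK] : forall i, exists K, forall t, 0 <= t <= T -> `|X t i 0| <= K.
  move=> i; have cn : {within `[0, T], continuous (fun t => `|X t i 0|)}.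
    by apply: continuous_subspaceT => t; apply: cvg_norm; exact: cX.
  have [c _ hc] := EVT_max (ltW T0) cn.
  by exists `|X c i 0| => t tT; apply: hc; rewrite in_itv.
have K0 i : 0 <= K i.
  by apply: le_trans (hK i 0 _); rewrite ?lexx ?(ltW T0).
exists (\sum_i K i); first exact: sumr_ge0.
move=> t tT i; apply: le_trans (hK i t tT) _.
by rewrite (bigD1 i)//= lerDl sumr_ge0.
Qed.

(** The difference [d] of the trajectories solves a linear equation with matrix [odeA (w_ n)] whose
    forcing is evaluated along the limit trajectory. Hence the sup bounds of the fixed functions [X]
    and [clamped T u] control it for all [n] at once. *)
Lemma output_stability (w_ : I -> param R r s m) w (X_ : I -> R -> 'cV[R]_r) X :
  (forall n, ode_solution T u (w_ n) (X_ n)) -> ode_solution T u w X ->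
  mx_cvg F (px0 \o w_) (px0 w) ->
  mx_cvg F (odeA \o w_) (odeA w) -> mx_cvg F (odeB \o w_) (odeB w) ->
  mx_cvg F (outA \o w_) (outA w) -> mx_cvg F (outB \o w_) (outB w) ->
  exists2 sigma : I -> R, sigma @ F --> 0 & \forall n \near F,
    forall t i, 0 <= t <= T ->
      `|(outA (w_ n) *m X_ n t + outB (w_ n) *m clamped T u t -
         (outA w *m X t + outB w *m clamped T u t)) i 0| <= sigma n.
Proof.
move=> hX_ hX cx cA cB cC cD.
have cv := clamped_continuous T0 hu.
have [X0 cX dX] := hX.
have [K1 K10 hK1] := mx_continuous_bounded cX.
have [K2 K20 hK2] := mx_continuous_bounded cv.
(* Bounds each entry of the forcing, whose squared norm is then at most [r%:R * a n ^+ 2]. *)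
pose a n := l1norm (odeA (w_ n) - odeA w) * K1 + l1norm (odeB (w_ n) - odeB w) * K2.
have a_cvg : a @ F --> 0.
  have -> : 0 = 0 * K1 + 0 * K2 :> R by rewrite !mul0r addr0.
  by apply: cvgD; apply: cvgM; try exact: cvg_cst; exact: cvg_l1normB.
(* Eventually [odeA (w_ n)] is within 1 of its limit, so this [C], and with it [L], is independent
   of [n]. *)
pose C := l1norm (odeA w) + 1.
pose L := 2 * C * r%:R + 1.
have L0 : 0 <= L.
  by rewrite /L addr_ge0// !mulr_ge0// /C addr_ge0// l1norm_ge0.
(* Gronwall's bound at the final time, valid for [sqn (d t)] at every [t] of the interval. *)
pose rho n := expR (L * T) * (sqn (px0 (w_ n) - px0 w) + r%:R * a n ^+ 2 * T).
have rho_cvg : rho @ F --> 0.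
  have -> : 0 = expR (L * T) * (sqn (px0 w - px0 w) + r%:R * (0 * 0) * T).
    by rewrite subrr sqn0 !mulr0 mul0r addr0 mulr0.
  apply: cvgM; first exact: cvg_cst.
  apply: cvgD; first by apply: cvg_sqn; apply: mx_cvgB => //; exact: mx_cvg_cst.
  apply: cvgM; last exact: cvg_cst.
  apply: cvgM; first exact: cvg_cst.
  by under eq_fun do rewrite expr2; apply: cvgM.
(* The three terms follow the splitting of the output error into [outA (w_ n) *m d t] and the errors
   of [outA] and [outB] applied to the limit trajectory and to the input. *)
pose sigma n := l1norm (outA (w_ n)) * Num.sqrt (rho n)
  + l1norm (outA (w_ n) - outA w) * K1 + l1norm (outB (w_ n) - outB w) * K2.
exists sigma.
  have -> : 0 = l1norm (outA w) * Num.sqrt 0 + 0 * K1 + 0 * K2 :> R.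
    by rewrite sqrtr0 mulr0 !mul0r !addr0.
  apply: cvgD; last by apply: cvgM; [exact: cvg_l1normB|exact: cvg_cst].
  apply: cvgD; last by apply: cvgM; [exact: cvg_l1normB|exact: cvg_cst].
  apply: cvgM; first exact: cvg_l1norm.
  apply: continuous_cvg => //; exact: sqrt_continuous.
have nearA : \forall n \near F, l1norm (odeA (w_ n) - odeA w) <= 1.
  near=> n; apply: ltW; near: n.
  exact: (cvgr_lt 0 (cvg_l1normB cA) _ ltr01).
near=> n => t i tT.
have An : l1norm (odeA (w_ n) - odeA w) <= 1 by near: n.
have [Y0 cY dY] := hX_ n.
pose d x := X_ n x - X x.
pose f x := (odeA (w_ n) - odeA w) *m X x + (odeB (w_ n) - odeB w) *m clamped T u x.
have cd l : continuous (fun t => d t l 0).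
  move=> x; rewrite /d; under eq_fun do rewrite !mxE.
  by apply: cvgB; [exact: cY|exact: cX].
have dd x : 0 < x < T -> mx_is_derive d x (odeA (w_ n) *m d x + f x).
  move=> xT p q; rewrite /d.
  have -> : (fun t => (X_ n t - X t) p q) = (fun t => X_ n t p q) - (fun t => X t p q).
    by apply/funext => y; rewrite !mxE.
  apply: is_derive_eq (is_deriveB (dY x xT p q) (dX x xT p q)) _.
  rewrite /f mulmxBr !mulmxBl.
  move: (odeA (w_ n) *m X_ n x) (odeA (w_ n) *m X x) (odeA w *m X x)
    (odeB (w_ n) *m clamped T u x) (odeB w *m clamped T u x).
  by move=> z1 z2 z3 z4 z5; rewrite !mxE; ring.
have MC p q : `|odeA (w_ n) p q| <= C.
  have -> : odeA (w_ n) p q = odeA w p q + (odeA (w_ n) - odeA w) p q.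
    by rewrite [X in _ + X]mxE [X in _ + (_ + X)]mxE addrCA subrr addr0.
  apply: le_trans (ler_normD _ _) _; apply: lerD; first exact: coord_l1norm_le.
  exact: le_trans (coord_l1norm_le _ _ _) An.
have fa x : 0 < x < T -> sqn (f x) <= r%:R * a n ^+ 2.
  move=> /andP[/ltW x0 /ltW xT]; have xT' : 0 <= x <= T by rewrite x0.
  have -> : r%:R * a n ^+ 2 = \sum_(l < r) a n ^+ 2.
    by rewrite sumr_const card_ord mulr_natl.
  apply: ler_sum => l _.
  rewrite -real_normK ?num_real// ler_pXn2r ?nnegrE//; last first.
    by rewrite /a addr_ge0// mulr_ge0// l1norm_ge0.
  rewrite /f mxE; apply: le_trans (ler_normD _ _) _.
  apply: lerD; apply: mulmx_l1norm_le => j; [exact: hK1|exact: hK2].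
have [t0 tT'] := andP tT.
have drho : sqn (d t) <= rho n.
  apply: le_trans (gronwall (ltW T0) cd dd MC fa tT) _.
  rewrite /rho -/L /d Y0 X0.
  have e0 : 0 <= r%:R * a n ^+ 2 by rewrite mulr_ge0// sqr_ge0.
  apply: ler_pM; rewrite ?expR_ge0//.
  - by rewrite addr_ge0 ?sqn_ge0// mulr_ge0.
  - by rewrite ler_expR ler_wpM2l.
  - by rewrite lerD2l ler_wpM2l.
have dj j : `|d t j 0| <= Num.sqrt (rho n).
  rewrite -[leLHS]ger0_norm// -sqrtr_sqr ler_wsqrtr//.
  rewrite real_normK ?num_real//.
  exact: le_trans (sqn_coord_le _ _) drho.
have -> : outA (w_ n) *m X_ n t + outB (w_ n) *m clamped T u t -
    (outA w *m X t + outB w *m clamped T u t) =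
  outA (w_ n) *m d t + (outA (w_ n) - outA w) *m X t +
    (outB (w_ n) - outB w) *m clamped T u t.
  rewrite /d mulmxBr !mulmxBl.
  move: (outA (w_ n) *m X_ n t) (outA (w_ n) *m X t) (outA w *m X t)
    (outB (w_ n) *m clamped T u t) (outB w *m clamped T u t).
  by move=> z1 z2 z3 z4 z5; apply/matrixP => p q; rewrite !mxE; ring.
rewrite mxE [X in X + _]mxE.
apply: le_trans (ler_normD _ _) _; apply: lerD.
  apply: le_trans (ler_normD _ _) _; apply: lerD; apply: mulmx_l1norm_le => j.
    exact: dj.
  exact: hK1.
by apply: mulmx_l1norm_le => j; exact: hK2.
Unshelve. all: by end_near. Qed.

End StateStability.

(** * Admissible parameters and cost *)

Section ParameterConvergence.
Context {R : realType} {r s m : nat} (eps : R) (eps0 : 0 < eps).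
Context {I : Type} (F : set_system I) {FF : UltraFilter F}.
Implicit Types w : param R r s m.

Definition param_cvg (w_ : I -> param R r s m) w : Prop :=
  [/\ mx_cvg F (pJ \o w_) (pJ w), mx_cvg F (pR \o w_) (pR w),
      mx_cvg F (pB \o w_) (pB w) & mx_cvg F (px0 \o w_) (px0 w)].

Lemma sysmx_cvg (w_ : I -> param R r s m) w : param_cvg w_ w -> mx_cvg F (sysmx \o w_) (sysmx w).
Proof. by move=> [cJ cR _ _]; exact: mx_cvgB cJ cR. Qed.

Lemma algmx_cvg (w_ : I -> param R r s m) w : param_cvg w_ w -> mx_cvg F (algmx \o w_) (algmx w).
Proof.
by move=> /sysmx_cvg h; exact: (mx_cvg_rsubmx (mx_cvg_dsubmx h)).
Qed.

(** Equalities and weak inequalities pass to the limit; [le_sigma_min] brings the singular value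
    constraint into that form. *)
Lemma Uad_cvg (w_ : I -> param R r s m) w : (forall n, Uad r s m eps (w_ n)) -> param_cvg w_ w ->
  Uad r s m eps w.
Proof.
move=> Uw cw; have [cJ cR _ _] := cw.
have cc p q (A : 'M[R]_(p, q)) : mx_cvg F (fun=> A) A by exact: mx_cvg_cst.
split.
- apply: (mx_cvg_unique (mx_cvgT cJ)).
  have -> : (fun n => ((pJ \o w_) n)^T) = (fun n => - pJ (w_ n)).
    by apply/funext => n /=; have [-> _ _] := Uw n.
  exact: mx_cvgN cJ.
- split.
    apply: (mx_cvg_unique (mx_cvgT cR)).
    have -> // : (fun n => ((pR \o w_) n)^T) = pR \o w_.
    by apply/funext => n /=; have [_ [-> _] _] := Uw n.
  move=> v.
  have h : mx_cvg F (fun n => v^T *m pR (w_ n) *m v) (v^T *m pR w *m v).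
    by apply: mx_cvgM (cc _ _ v); exact: mx_cvgM (cc _ _ v^T) cR.
  apply: (cvgr_to_ge (h 0 0)).
  by apply: nearW => n; have [_ [_ +] _] := Uw n; apply.
- have -> : drsubmx (pJ w) - drsubmx (pR w) = algmx w.
    by rewrite /algmx /sysmx; apply/matrixP => i j; rewrite !mxE.
  apply/le_sigma_min => // v.
  have h : sqn (algmx (w_ n) *m v) @[n --> F] --> sqn (algmx w *m v).
    by apply: cvg_sqn; exact: mx_cvgM (algmx_cvg cw) (cc _ _ v).
  apply: (cvgr_to_ge h); apply: nearW => n.
  exact: Uad_coercive.
Qed.

(** The formulas are polynomial in the entries of [w] and of the inverse block; admissibility of
    every [w_ n] is what makes the inverses converge. *)
Lemma reduction_cvg (w_ : I -> param R r s m) w : (forall n, Uad r s m eps (w_ n)) -> param_cvg w_ w ->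
  [/\ mx_cvg F (odeA \o w_) (odeA w), mx_cvg F (odeB \o w_) (odeB w),
      mx_cvg F (outA \o w_) (outA w) & mx_cvg F (outB \o w_) (outB w)].
Proof.
move=> Uw cw; have [_ _ cB _] := cw; have cS := sysmx_cvg cw.
have cI : mx_cvg F (fun n => invmx (algmx (w_ n))) (invmx (algmx w)).
  apply: (invmx_cvg eps0) (algmx_cvg cw) => n v; exact: Uad_coercive.
have c11 := mx_cvg_lsubmx (mx_cvg_usubmx cS).
have c12 := mx_cvg_rsubmx (mx_cvg_usubmx cS).
have c21 := mx_cvg_lsubmx (mx_cvg_dsubmx cS).
have c1 := mx_cvg_usubmx cB; have c2 := mx_cvg_dsubmx cB.
have cAA : mx_cvg F (algA \o w_) (algA w) by exact: mx_cvgN (mx_cvgM cI c21).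
have cAB : mx_cvg F (algB \o w_) (algB w) by exact: mx_cvgN (mx_cvgM cI c2).
split.
- exact: mx_cvgB c11 (mx_cvgM (mx_cvgM c12 cI) c21).
- exact: mx_cvgB c1 (mx_cvgM (mx_cvgM c12 cI) c2).
- exact: mx_cvgD (mx_cvgT c1) (mx_cvgM (mx_cvgT c2) cAA).
- exact: mx_cvgM (mx_cvgT c2) cAB.
Qed.

End ParameterConvergence.

(** * Frobenius norms and bounded families of parameters *)

Section Norms.
Context {R : realType}.

Lemma norm2_sqr p q (A : 'M[R]_(p, q)) : norm2 A ^+ 2 = \sum_i \sum_j A i j ^+ 2.
Proof.
rewrite /norm2 sqr_sqrtr//; apply: sumr_ge0 => i _; apply: sumr_ge0 => j _.
exact: sqr_ge0.
Qed.

Lemma norm2_sqn p (v : 'cV[R]_p) : norm2 v ^+ 2 = sqn v.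
Proof. by rewrite norm2_sqr; apply: eq_bigr => i _; rewrite big_ord1. Qed.

Lemma coord_norm2_le p q (A : 'M[R]_(p, q)) i j : A i j ^+ 2 <= norm2 A ^+ 2.
Proof.
rewrite norm2_sqr (bigD1 i)//= (bigD1 j)//= -addrA lerDl addr_ge0//.
  by apply: sumr_ge0 => *; exact: sqr_ge0.
by apply: sumr_ge0 => ? _; apply: sumr_ge0 => *; exact: sqr_ge0.
Qed.

Lemma norm2_bound p q (A A0 : 'M[R]_(p, q)) d i j : 0 <= d ->
  norm2 (A - A0) ^+ 2 <= d ^+ 2 -> `|A i j| <= norm2 A0 + d.
Proof.
move=> d0 h; have := coord_norm2_le (A - A0) i j; rewrite !mxE => h1.
have h2 : `|A i j - A0 i j| <= d.
  rewrite -(ler_pXn2r (_ : 0 < 2)%N)// ?nnegrE// real_normK ?num_real//.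
  exact: le_trans h.
have h3 : `|A0 i j| <= norm2 A0.
  rewrite -(ler_pXn2r (_ : 0 < 2)%N)// ?nnegrE ?sqrtr_ge0// real_normK ?num_real//.
  exact: coord_norm2_le.
have := ler_normD (A i j - A0 i j) (A0 i j); rewrite subrK; lra.
Qed.

Context {r s m : nat}.
Implicit Types w : param R r s m.

Lemma param_dist_sqr w w' : param_dist w w' ^+ 2 =
  norm2 (pJ w - pJ w') ^+ 2 + norm2 (pR w - pR w') ^+ 2 +
  norm2 (pB w - pB w') ^+ 2 + norm2 (px0 w - px0 w') ^+ 2.
Proof. by rewrite /param_dist sqr_sqrtr// !addr_ge0// sqr_ge0. Qed.

Context {I : Type} (F : set_system I).

Lemma cvg_norm2_sqr {FF : ProperFilter F} p q (A : I -> 'M[R]_(p, q)) a :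
  mx_cvg F A a -> norm2 (A n) ^+ 2 @[n --> F] --> norm2 a ^+ 2.
Proof.
move=> cA; rewrite norm2_sqr; under eq_fun do rewrite norm2_sqr.
apply: cvg_sumr => i _; apply: cvg_sumr => j _; rewrite expr2.
by under eq_fun do rewrite expr2; apply: cvgM; exact: cA.
Qed.

Lemma cvg_param_dist_sqr {FF : ProperFilter F} (w_ : I -> param R r s m) w w' : param_cvg F w_ w ->
  param_dist (w_ n) w' ^+ 2 @[n --> F] --> param_dist w w' ^+ 2.
Proof.
move=> [cJ cR cB cx]; rewrite param_dist_sqr.
under eq_fun do rewrite param_dist_sqr.
apply: cvgD; last by apply: cvg_norm2_sqr; apply: mx_cvgB => //; exact: mx_cvg_cst.
apply: cvgD; last by apply: cvg_norm2_sqr; apply: mx_cvgB => //; exact: mx_cvg_cst.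
by apply: cvgD; apply: cvg_norm2_sqr; apply: mx_cvgB => //; exact: mx_cvg_cst.
Qed.

(** The centre [w0] is left free: it is [wref] when [lambda] is positive and zero when the
    admissible set is bounded. *)
Lemma param_bounded_cvg {FF : UltraFilter F} (w_ : I -> param R r s m) w0 d :
  0 <= d -> (forall n, param_dist (w_ n) w0 <= d) -> exists w, param_cvg F w_ w.
Proof.
move=> d0 h.
have h2 n : param_dist (w_ n) w0 ^+ 2 <= d ^+ 2.
  by rewrite ler_pXn2r ?nnegrE ?sqrtr_ge0.
have hJ n : norm2 (pJ (w_ n) - pJ w0) ^+ 2 <= d ^+ 2.
  apply: le_trans (h2 n); rewrite param_dist_sqr -!addrA lerDl.
  by rewrite !addr_ge0// sqr_ge0.
have hR n : norm2 (pR (w_ n) - pR w0) ^+ 2 <= d ^+ 2.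
  apply: le_trans (h2 n); rewrite param_dist_sqr -!addrA addrCA lerDl.
  by rewrite !addr_ge0// sqr_ge0.
have hB n : norm2 (pB (w_ n) - pB w0) ^+ 2 <= d ^+ 2.
  apply: le_trans (h2 n); rewrite param_dist_sqr addrAC lerDr.
  by rewrite !addr_ge0// sqr_ge0.
have hx n : norm2 (px0 (w_ n) - px0 w0) ^+ 2 <= d ^+ 2.
  apply: le_trans (h2 n); rewrite param_dist_sqr lerDr.
  by rewrite !addr_ge0// sqr_ge0.
have [J cJ] := ultra_mx_cvg (fun n i j => norm2_bound i j d0 (hJ n)).
have [K cR] := ultra_mx_cvg (fun n i j => norm2_bound i j d0 (hR n)).
have [B cB] := ultra_mx_cvg (fun n i j => norm2_bound i j d0 (hB n)).
have [x cx] := ultra_mx_cvg (fun n i j => norm2_bound i j d0 (hx n)).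
by exists (J, K, B, x); split.
Qed.

End Norms.

(** * Reduction of the cost to the parameters *)

Section Cost.
Context {R : realType} {r s m : nat} (T lambda eps : R) (T0 : 0 < T) (eps0 : 0 < eps).
Variables (u : R -> 'cV[R]_m) (hu : C1_closed_vec T u).
Variables (yd : R -> 'cV[R]_m) (hyd : L2_vec T yd) (wref : param R r s m).
Local Notation mu := (@lebesgue_measure R).
Local Notation D := (`]0, T[%classic : set R).
Implicit Types (w : param R r s m) (y : R -> 'cV[R]_m).

Lemma misfit_integrable y : L2_vec T y ->
  mu.-integrable D (EFin \o (fun t => norm2 (y t - yd t) ^+ 2)).
Proof.
move=> hy.
have -> : EFin \o (fun t => norm2 (y t - yd t) ^+ 2) =
    (fun t => (\sum_i ((y t i 0 - yd t i 0) * (y t i 0 - yd t i 0))%:E)%E).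
  apply/funext => t; rewrite /= norm2_sqn sumEFin; congr (_%:E).
  by apply: eq_bigr => i _; rewrite !mxE expr2.
apply: integrable_sum; first exact: measurable_oo.
by move=> i _; have h := L2_sub (hy i) (hyd i); exact: (L2_mul h h).
Qed.

Lemma residual_integrable y : L2_vec T y ->
  mu.-integrable D (EFin \o (fun t => \sum_i `|(y t - yd t) i 0|)).
Proof.
move=> hy.
have -> : EFin \o (fun t => \sum_i `|(y t - yd t) i 0|) =
    (fun t => (\sum_i (`|y t i 0 - yd t i 0|)%:E)%E).
  apply/funext => t; rewrite /= sumEFin; congr (_%:E).
  by apply: eq_bigr => i _; rewrite !mxE.
apply: integrable_sum; first exact: measurable_oo.
move=> i _; apply: integrable_norm; apply: L2_integrable.
exact: L2_sub.
Qed.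

Lemma ae_cost y y' w : L2_vec T y -> L2_vec T y' ->
  {ae mu, forall t, 0 < t < T -> y t = y' t} ->
  cost T lambda yd wref y w = cost T lambda yd wref y' w.
Proof.
move=> hy hy' yy'; rewrite /cost; congr (_ * _ + _); congr fine.
apply: ae_eq_integral.
- exact: measurable_oo.
- by have /integrableP[] := misfit_integrable hy.
- by have /integrableP[] := misfit_integrable hy'.
- by apply: ae_imply yy' => t h; rewrite /= in_itv/= => /h ->.
Qed.

(* Convexity: [|b| ^+ 2 >= |a| ^+ 2 - 2 * |b - a| * |a|] for [a = y - yd] and
   [b = y' - yd]. *)
Lemma misfit_lower_bound y y' sigma : L2_vec T y -> L2_vec T y' ->
  (forall t i, 0 <= t <= T -> `|(y' t - y t) i 0| <= sigma) ->
  \int[mu]_(t in D) (norm2 (y t - yd t) ^+ 2) <=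
  \int[mu]_(t in D) (norm2 (y' t - yd t) ^+ 2) +
  2 * sigma * \int[mu]_(t in D) (\sum_i `|(y t - yd t) i 0|).
Proof.
move=> hy hy' hsigma.
have iy := misfit_integrable hy; have iy' := misfit_integrable hy'.
have ir := residual_integrable hy.
have ir2 : mu.-integrable D
    (EFin \o (fun t => 2 * sigma * \sum_i `|(y t - yd t) i 0|)).
  have := integrableZl (measurable_oo T) (2 * sigma) ir.
  by congr (is_true (integrable _ _ _)); apply/funext => t; rewrite /= EFinM.
have <- := @RintegralZl _ _ R mu D _ (2 * sigma) (measurable_oo T) ir.
have <- := @RintegralD _ _ R mu D _ _ (measurable_oo T) iy' ir2.
apply: le_Rintegral => //.
  have := integrableD (measurable_oo T) iy' ir2.
  by congr (is_true (integrable _ _ _)); apply/funext => t; rewrite /= EFinD.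
move=> t; rewrite /= in_itv/= => /andP[/ltW t0 /ltW tT].
rewrite !norm2_sqn /sqn mulr_sumr -big_split/=; apply: ler_sum => i _.
have := hsigma t i; rewrite t0 tT => /(_ isT).
rewrite !mxE; set a := y t i 0; set b := y' t i 0; set c := yd t i 0 => h.
have e : (b - c) ^+ 2 = (a - c) ^+ 2 + 2 * ((b - a) * (a - c)) + (b - a) ^+ 2 by ring.
have h2 : - (`|b - a| * `|a - c|) <= (b - a) * (a - c).
  by rewrite -normrM lerNl; have := ler_norm (- ((b - a) * (a - c))); rewrite normrN.
have h3 : `|b - a| * `|a - c| <= sigma * `|a - c| by apply: ler_wpM2r.
have := sqr_ge0 (b - a); lra.
Qed.

(** Here [y] plays the limit and [y'] a term of the minimising sequence: the factor of [sigma]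
    involves [y] alone, so this error tends to zero with [sigma]. *)
Lemma cost_lower_bound y y' w w' sigma : L2_vec T y -> L2_vec T y' ->
  (forall t i, 0 <= t <= T -> `|(y' t - y t) i 0| <= sigma) ->
  cost T lambda yd wref y w <= cost T lambda yd wref y' w' +
    (sigma * \int[mu]_(t in D) (\sum_i `|(y t - yd t) i 0|) +
     lambda / 2 * (param_dist w wref ^+ 2 - param_dist w' wref ^+ 2)).
Proof.
have arith (a b A B g k l : R) : a <= b + 2 * g * k ->
  2^-1 * a + l / 2 * A <= 2^-1 * b + l / 2 * B + (g * k + l / 2 * (A - B)) by lra.
by move=> hy hy' /(misfit_lower_bound hy hy')/arith; exact.
Qed.

Definition ode_output w (X : R -> 'cV[R]_r) t :=
  outA w *m X t + outB w *m clamped T u t.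

Lemma ode_output_L2 w X : ode_solution T u w X -> L2_vec T (ode_output w X).
Proof.
move=> hX; have [dy [H _ _] _] := ode_solution_H1 T0 hu (outA w) (outB w) hX.
by move=> i; have [] := H i.
Qed.

Lemma Uad_unitmx w : Uad r s m eps w -> algmx w \in unitmx.
Proof. by move=> Uw; apply: (coercive_unitmx eps0); exact: Uad_coercive. Qed.

Lemma ode_feasible w X : Uad r s m eps w -> ode_solution T u w X ->
  feasible T eps u (ode_output w X) w.
Proof.
move=> Uw hX; split => //.
  by have [dy [H _ _] _] := ode_solution_H1 T0 hu (outA w) (outB w) hX.
exists (fun t => fullstate w (X t) (clamped T u t)).
  by apply: ode_state_solution => //; exact: Uad_unitmx.
by apply: (@aeW _ _ _ mu) => t _; rewrite output_fullstate.
Qed.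

(** Replaces any feasible output by the classical one at equal cost, so that minimising over pairs
    becomes minimising over [w]. *)
Lemma feasible_ode y w : feasible T eps u y w ->
  exists X, [/\ Uad r s m eps w, ode_solution T u w X &
    cost T lambda yd wref y w = cost T lambda yd wref (ode_output w X) w].
Proof.
move=> [Hy Uw [x hx yx]]; have [X hX] := ode_solution_exists T0 hu w.
exists X; split; [exact: Uw|exact: hX|apply: ae_cost].
- by move=> i; have [] := Hy i.
- exact: ode_output_L2.
- have xX := state_solution_unique T0 hu (Uad_unitmx Uw) hX hx.
  apply: ae_imply (ae_and xX yx) => t [h1 h2] tT.
  by rewrite h2// h1// output_fullstate.
Qed.

Lemma cost_ge0 y w : 0 <= lambda -> 0 <= cost T lambda yd wref y w.
Proof.
move=> l0; rewrite /cost addr_ge0// mulr_ge0// ?sqr_ge0 ?divr_ge0//.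
by apply: Rintegral_ge0 => t _; exact: sqr_ge0.
Qed.

Lemma Uad_nonempty : exists w, Uad r s m eps w.
Proof.
(* Here [J22 - R22] is [- eps] times the identity, so the constraint holds with equality. *)
exists (0, eps%:M, 0, 0); split.
- by rewrite /pJ/= trmx0 oppr0.
- split; first by rewrite /pR/= tr_scalar_mx.
  move=> v; rewrite /pR/= mul_mx_scalar -scalemxAl mxE -sqn_mul.
  by rewrite mulr_ge0 ?sqn_ge0// ltW.
- apply/le_sigma_min => // v.
  have e : drsubmx (0 : 'M[R]_(r + s)) - drsubmx (eps%:M : 'M[R]_(r + s)) =
      - eps%:M.
    rewrite scalar_mx_block block_mxKdr.
    by apply/matrixP => i j; rewrite !mxE sub0r.
  rewrite /pJ /pR/= e.
  by rewrite mulNmx mul_scalar_mx -scaleNr sqnZ sqrrN.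
Qed.

End Cost.

Theorem theorem4 (R : realType) (r s m : nat) (T eps lambda : R)
    (u ydata : R -> 'cV[R]_m) (wref : param R r s m)
    (hr : (1 <= r)%N) (hm : (1 <= m)%N) (hT : 0 < T) (heps : 0 < eps)
    (hlambda : 0 <= lambda) (hu : C1_closed_vec T u) (hydata : L2_vec T ydata)
    (hcoercive : 0 < lambda \/ param_bounded (Uad r s m eps)) :
  exists (y : R -> 'cV[R]_m) (w : param R r s m),
    feasible T eps u y w /\
    forall (y' : R -> 'cV[R]_m) (w' : param R r s m),
      feasible T eps u y' w' ->
      cost T lambda ydata wref y w <= cost T lambda ydata wref y' w'.
Proof.
pose J := cost T lambda ydata wref.
have J0 y w : 0 <= J y w by exact: cost_ge0.
pose S := [set c | exists y w, feasible T eps u y w /\ c = J y w].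
have infS : has_inf S.
  split; last by exists 0 => _ [y [w [_ ->]]].
  have [w0 Uw0] := @Uad_nonempty R r s m eps heps.
  have [X0 hX0] := ode_solution_exists hT hu w0.
  by exists (J (ode_output T u w0 X0) w0), (ode_output T u w0 X0), w0; split => //;
    exact: ode_feasible.
(* The minimising sequence carries its classical trajectories, the objects compared by
   [output_stability]. *)
have /choice[p hp] (n : nat) : exists p : param R r s m * (R -> 'cV[R]_r),
    [/\ Uad r s m eps p.1, ode_solution T u p.1 p.2 &
        J (ode_output T u p.1 p.2) p.1 < inf S + n.+1%:R^-1].
  have [|_ [y [w [fyw ->]]] Jyw] := @inf_adherent _ S n.+1%:R^-1 _ infS.
    by rewrite invr_gt0.
  have [X [Uw hX JX]] := feasible_ode lambda hT heps hu hydata wref fyw.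
  exists (w, X); split; [exact: Uw|exact: hX|].
  by rewrite /= /J -JX; exact: Jyw.
pose w_ n := (p n).1; pose X_ n := (p n).2.
have Uw n : Uad r s m eps (w_ n) by case: (hp n).
have hX n : ode_solution T u (w_ n) (X_ n) by case: (hp n).
have Jw n : J (ode_output T u (w_ n) (X_ n)) (w_ n) < inf S + n.+1%:R^-1.
  by case: (hp n).
have [w0 [d [d0 hd]]] : exists w0 d, 0 <= d /\ forall n, param_dist (w_ n) w0 <= d.
  case: hcoercive => [l0|[C hC]]; last first.
    exists (0, 0, 0, 0), `|C|; split => // n.
    exact: le_trans (hC _ (Uw n)) (ler_norm _).
  (* The regularisation term is at most the cost, which is at most [inf S + 1] since the slack
     [n.+1%:R^-1] never exceeds 1. *)
  exists wref, (Num.sqrt (2 / lambda * (inf S + 1))); split; first exact: sqrtr_ge0.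
  move=> n; rewrite /param_dist ler_wsqrtr// -param_dist_sqr.
  have h1 : J (ode_output T u (w_ n) (X_ n)) (w_ n) <= inf S + 1.
    apply: ltW (lt_le_trans (Jw n) _); rewrite lerD2l.
    by rewrite invf_le1 ?ltr0n// ler1n.
  have h2 : lambda / 2 * param_dist (w_ n) wref ^+ 2 <= inf S + 1.
    apply: le_trans h1; rewrite /J /cost lerDr mulr_ge0//.
    by apply: Rintegral_ge0 => t _; exact: sqr_ge0.
  rewrite -ler_pdivrMl ?divr_gt0// invf_div.
  exact: h2.
(* Taken finer than [\oo], so that the slack still tends to zero along [F]. *)
have [F [FU ooF]] := ultraFilterLemma (_ : ProperFilter (\oo : set_system nat)).
have FP : ProperFilter F by exact: ultra_proper.
have [w cw] := param_bounded_cvg d0 hd.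
have Uadw : Uad r s m eps w by exact: (Uad_cvg heps Uw cw).
have [X hXw] := ode_solution_exists hT hu w.
have [cA cB cC cD] := reduction_cvg heps Uw cw.
have [_ _ _ cx] := cw.
have [sigma sigma0 hsigma] := output_stability hT hu hX hXw cx cA cB cC cD.
pose y := ode_output T u w X.
exists y, w; split; first exact: ode_feasible.
move=> y' w' fyw'; apply: (@le_trans _ _ (inf S)); last first.
  by apply: ge_inf; [case: infS|exists y', w'].
pose K := \int[lebesgue_measure]_(t in `]0, T[) (\sum_i `|(y t - ydata t) i 0|).
(* The right-hand side of [cost_lower_bound], with the cost of step [n] replaced by its upper bound.
   The regularisation terms cancel in the limit because [w_] converges to [w]. *)
pose bound n := inf S + n.+1%:R^-1 + sigma n * K
  + lambda / 2 * (param_dist w wref ^+ 2 - param_dist (w_ n) wref ^+ 2).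
have bound_cvg : bound @ F --> inf S.
  rewrite -[X in _ --> X]addr0 -{1}[X in X + _](addr0 (inf S)).
  have -> : inf S + 0 + 0 = inf S + 0 + 0 * K
      + lambda / 2 * (param_dist w wref ^+ 2 - param_dist w wref ^+ 2).
    by rewrite mul0r subrr mulr0 !addr0.
  apply: cvgD.
    apply: cvgD; last by apply: cvgM => //; exact: cvg_cst.
    apply: cvgD; first exact: cvg_cst.
    by move=> A /(@cvg_harmonic R) hA; exact: ooF hA.
  apply: cvgM; first exact: cvg_cst.
  by apply: cvgB; [exact: cvg_cst|exact: cvg_param_dist_sqr].
apply: (cvgr_to_ge bound_cvg); near=> n.
have sn : forall t i, 0 <= t <= T ->
  `|(ode_output T u (w_ n) (X_ n) t - y t) i 0| <= sigma n by near: n.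
have yL : L2_vec T y by exact: ode_output_L2.
have ynL : L2_vec T (ode_output T u (w_ n) (X_ n)) by exact: ode_output_L2.
have h := cost_lower_bound lambda hydata wref w (w_ n) yL ynL sn.
by rewrite /bound -addrA; apply: le_trans h _; rewrite lerD2r ltW.
Unshelve. all: by end_near. Qed.
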